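(* Let $p\in(1,\infty)$ and $\omega\in A_p$, put $\omega'=\omega^{-1/(p-1)}$ and $\beta_\omega:=1-(1-\alpha_0)^p/[\omega]_{A_p}$, where $\alpha_0$ is the reverse doubling constant of $X$. Let $1<p<t<\min\{r,\ \log_2(\beta_\omega^{-1})\,r/n\}<\infty$, or let $1<p\le t<r=\infty$. Then the dual of $\mathcal H_{p',\omega'}^{t',r'}$ is $M_{p,\omega}^{t,r}$ in the following sense: (i) for any $g\in M_{p,\omega}^{t,r}$, the linear functional $J_g$ defined by $J_g(f):=\int_Xf(x)g(x)\,d\mu(x)$ for $f\in\mathcal H_{p',\omega'}^{t',r'}$ is bounded on $\mathcal H_{p',\omega'}^{t',r'}$; (ii) for any $J\in(\mathcal H_{p',\omega'}^{t',r'})^\ast$ there exists a unique $g\in M_{p,\omega}^{t,r}$ such that $J=J_g$ in $(\mathcal H_{p',\omega'}^{t',r'})^\ast$; moreover, $\|g\|_{M_{p,\omega}^{t,r}}=\|J\|_{(\mathcal H_{p',\omega'}^{t',r'})^\ast}$.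
   Context: Setting: $(X,\rho,\mu)$ is a space of homogeneous type with quasidistance $\rho$ and nonnegative Borel measure $\mu$, $\mu(X)=\infty$. $B(x,r)=\{y:\rho(x,y)<r\}$, $V(x,r)=\mu(B(x,r))$. Doubling: $V(x,2r)\le CV(x,r)$ for all $x\in X$, $r>0$; $n>0$ is a fixed constant such that $V(x,\lambda r)\le C\lambda^nV(x,r)$ for all $\lambda\ge1$, $x\in X$, $r>0$. Dyadic cubes: fix a Christ dyadic system $\mathcal D=\{Q_\tau^k:k\in\mathbb Z,\tau\in I_k\}$ of open subsets of $X$ such that: $\mu(X\setminus\bigcup_{\tau\in I_k}Q_\tau^k)=0$ for all $k$; if $i\ge k$ then either $Q_\tau^i\subset Q_\beta^k$ or $Q_\tau^i\cap Q_\beta^k=\emptyset$; for each $(k,\tau)$ and $i<k$ there is a unique $\tau'$ with $Q_\tau^k\subset Q_{\tau'}^i$; $\operatorname{diam}Q_\tau^k\le\kappa_0\gamma^k$; each $Q_\tau^k$ contains a ball $B(x_{Q_\tau^k},a_0\gamma^k)$. Here $\kappa_0\in(0,\infty)$ and $\gamma=a_0=1/2$ (normalized). The parent of $Q_\tau^k$ is the cube $Q_{\tau'}^{k-1}$ containing it. Reverse doubling: there is $\alpha_0\in(0,1)$ (the reverse doubling constant) with $\mu(Q)\le\alpha_0\mu(R)$ whenever $Q$ is a dyadic cube and $R$ is its parent. Weights: a weight is a locally integrable function on $X$ with values in $(0,\infty)$ a.e.; $\omega(E)=\int_E\omega\,d\mu$. For $1<p<\infty$, $\omega\in A_p$ iff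 $[\omega]_{A_p}:=\sup_B\big(\frac1{\mu(B)}\int_B\omega\,d\mu\big)\big(\frac1{\mu(B)}\int_B\omega^{-1/(p-1)}d\mu\big)^{p-1}<\infty$, supremum over all balls $B$. Primes on exponents denote conjugates ($1/p+1/p'=1$), while $\omega'=\omega^{-1/(p-1)}$. Bourgain-Morrey space: $\|f\|_{M_{p,\omega}^{t,r}}:=\Big\|\big\{\omega(Q_\tau^k)^{1/t-1/p}\big(\int_{Q_\tau^k}|f|^p\omega\,d\mu\big)^{1/p}\big\}_{k\in\mathbb Z,\tau\in I_k}\Big\|_{\ell^r}$; $M_{p,\omega}^{t,r}$ is the space of $f\in L^p_{\rm loc}(\omega)$ with finite norm. Block space: a function $b$ is a $(p',t',\omega')$-block supported in a dyadic cube $Q$ if $\operatorname{supp}b\subset Q$ and $\big(\int_Q|b(x)|^{p'}\omega(x)^{-1/(p-1)}d\mu(x)\big)^{1/p'}\le\omega(Q)^{1/t-1/p}$. The space $\mathcal H_{p',\omega'}^{t',r'}$ is the set of all measurable $f$ on $X$ that can be written $f=\sum_{k\in\mathbb Z}\sum_{\tau\in I_k}\lambda_{k,\tau}b_{k,\tau}$ $\mu$-a.e., with $\{\lambda_{k,\tau}\}\in\ell^{r'}$ and each $b_{k,\tau}$ a $(p',t',\omega')$-block supported in $Q_\tau^k$; its norm is the infimum of $\|\{\lambda_{k,\tau}\}\|_{\ell^{r'}}$ over all such decompositions. The dual $Y^\ast$ of $Y$ is the space of continuous linear functionals $T$ on $Y$ with $\|T\|_{Y^\ast}=\sup_{\|f\|_Y\le1}|T(f)|$.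 *)

(* Defs.v *)
From mathcomp Require Import all_boot all_order all_algebra.
From mathcomp Require Import all_classical all_reals all_analysis.

Set Implicit Arguments.
Unset Strict Implicit.
Unset Printing Implicit Defensive.

Import Order.TTheory GRing.Theory Num.Theory.

Local Open Scope classical_set_scope.
Local Open Scope ring_scope.

Section quasi_metric.
Context {R : realType} {X : Type}.
Variable rho : X -> X -> R.

Record quasi_distance : Prop := QuasiDistance {
  qd_ge0 : forall x y, 0 <= rho x y ;
  qd_eq0 : forall x y, rho x y = 0 <-> x = y ;
  qd_sym : forall x y, rho x y = rho y x ;
  qd_triangle : exists K : R, forall x y z,
    rho x z <= K * (rho x y + rho y z)
}.

Definition qball (x : X) (s : R) : set X := [set y | rho x y < s].

(* Balls of a quasidistance need not belong to this topology. *)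
Definition qopen (U : set X) : Prop :=
  forall x, U x -> exists2 s : R, 0 < s & qball x s `<=` U.

End quasi_metric.

(* The sigma-algebra of X is the Borel one; as balls need not be open, that
   they have a (positive and finite) volume is part of the definition.
   n is a fixed upper dimension and need not be optimal. *)
Record homogeneous_space {R : realType} {d : measure_display}
    {X : measurableType d} (rho : X -> X -> R)
    (mu : {measure set X -> \bar R}) (n : R) : Prop := HomogeneousSpace {
  hs_quasi_distance : quasi_distance rho ;
  hs_borel : @measurable d X = <<s [set U | qopen rho U] >> ;
  hs_measurable_ball : forall x s, measurable (qball rho x s) ;
  hs_volume : forall x s, 0 < s -> (0 < mu (qball rho x s) < +oo)%E ;
  hs_doubling : exists C : R, forall x s, 0 < s ->
    (mu (qball rho x (2 * s)) <= C%:E * mu (qball rho x s))%E ;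
  hs_dim_gt0 : 0 < n ;
  hs_dim : exists C : R, forall (l : R) x s, 1 <= l -> 0 < s ->
    (mu (qball rho x (l * s)) <= (C * l `^ n)%:E * mu (qball rho x s))%E ;
  hs_infinite : mu setT = +oo%E
}.

(* Christ's dyadic cubes, with gamma = a_0 = 1/2. *)
Record dyadic_system {R : realType} {d : measure_display}
    {X : measurableType d} (rho : X -> X -> R)
    (mu : {measure set X -> \bar R}) (I : int -> choiceType)
    (Q : forall k : int, I k -> set X) : Prop := DyadicSystem {
  ds_open : forall k tau, qopen rho (Q k tau) ;
  ds_cover : forall k, mu (~` (\bigcup_(tau in setT) Q k tau)) = 0%E ;
  ds_nested : forall (i k : int) tau beta, (k <= i)%R ->
    Q i tau `<=` Q k beta \/ Q i tau `&` Q k beta = set0 ;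
  ds_ancestor : forall (i k : int) tau, (i < k)%R ->
    exists! tau', Q k tau `<=` Q i tau' ;
  ds_diam : exists2 kappa0 : R, 0 < kappa0 & forall (k : int) tau x y,
    Q k tau x -> Q k tau y -> rho x y <= kappa0 * 2^-1 ^ k ;
  ds_inner_ball : forall (k : int) tau,
    exists x, qball rho x (2^-1 * 2^-1 ^ k) `<=` Q k tau
}.

Definition reverse_doubling {R : realType} {d : measure_display}
    {X : measurableType d} (mu : {measure set X -> \bar R})
    (I : int -> choiceType) (Q : forall k : int, I k -> set X)
    (alpha0 : R) : Prop :=
  0 < alpha0 < 1 /\
  forall (k : int) tau tau', Q k tau `<=` Q (k - 1) tau' ->
    (mu (Q k tau) <= alpha0%:E * mu (Q (k - 1)%R tau'))%E.

Section weights.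
Context {R : realType} {d : measure_display} {X : measurableType d}.
Variables (rho : X -> X -> R) (mu : {measure set X -> \bar R}).
Local Open Scope ereal_scope.

Definition is_weight (w : X -> R) : Prop :=
  [/\ measurable_fun setT w,
      forall x s, (0 < s)%R -> mu.-integrable (qball rho x s) (EFin \o w) &
      {ae mu, forall x, (0 < w x)%R}].

Definition wmeas (w : X -> R) (E : set X) : \bar R :=
  \int[mu]_(x in E) (w x)%:E.

Definition dual_weight (p : R) (w : X -> R) : X -> R :=
  fun x => (w x `^ (- (p - 1)^-1))%R.

Definition mean (f : X -> R) (B : set X) : \bar R :=
  (\int[mu]_(x in B) (f x)%:E) / mu B.

Definition Ap_const (p : R) (w : X -> R) : \bar R :=
  ereal_sup [set c | exists x s, (0 < s)%R /\
    c = mean w (qball rho x s) *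
        mean (dual_weight p w) (qball rho x s) `^ (p - 1)].

Definition Ap (p : R) (w : X -> R) : Prop :=
  is_weight w /\ Ap_const p w < +oo.

Definition beta_weight (alpha0 p : R) (w : X -> R) : R :=
  (1 - (1 - alpha0) `^ p / fine (Ap_const p w))%R.

End weights.

Definition log2 {R : realType} (x : R) : R := ln x / ln 2.

Definition lr_norm {R : realType} {T : choiceType} (r : \bar R)
    (a : T -> \bar R) : \bar R :=
  match r with
  | s%:E => (\esum_(i in setT) `|a i| `^ s) `^ s^-1
  | _ => ereal_sup (range (fun i => `|a i|))
  end%E.

Section spaces.
Context {R : realType} {d : measure_display} {X : measurableType d}.
Variables (rho : X -> X -> R) (mu : {measure set X -> \bar R}).
Variables (I : int -> choiceType) (Q : forall k : int, I k -> set X).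
Variables (w : X -> R) (p t : R) (r : \bar R).
Local Open Scope ereal_scope.

Local Notation index := {k : int & I k}.
Local Notation cube i := (Q (projT2 i)).
Local Notation p' := (fine (hoelder_conjugate p%:E)).

Definition Lp_loc (f : X -> R) : Prop :=
  measurable_fun setT f /\ forall x s, (0 < s)%R ->
    \int[mu]_(y in qball rho x s) (`|f y| `^ p * w y)%:E < +oo.

Definition BM_norm (f : X -> R) : \bar R :=
  lr_norm r (fun i : index => wmeas mu w (cube i) `^ (t^-1 - p^-1) *
    (\int[mu]_(x in cube i) (`|f x| `^ p * w x)%:E) `^ p^-1).

(* M_{p,w}^{t,r} *)
Definition BM_space : set (X -> R) :=
  [set f | Lp_loc f /\ BM_norm f < +oo].

(* (p',t',w')-blocks; the support condition is that b vanishes off A. *)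
Definition is_block (A : set X) (b : X -> R) : Prop :=
  [/\ measurable_fun setT b,
      forall x, ~ A x -> b x = 0%R &
      (\int[mu]_(x in A) (`|b x| `^ p' * dual_weight p w x)%:E) `^ p'^-1
        <= wmeas mu w A `^ (t^-1 - p^-1)].

(* The double series converges absolutely almost everywhere; its sum is the
   difference of the sums of its positive and negative parts. *)
Definition block_decomposition (f : X -> R) (lam : index -> R)
    (b : index -> X -> R) : Prop :=
  (forall i, is_block (cube i) (b i)) /\
  {ae mu, forall x, let u := fun i => (lam i * b i x)%:E in
    summable setT u /\ (f x)%:E = esum setT u^\+ - esum setT u^\-}.

Definition coef_norm (lam : index -> R) : \bar R :=
  lr_norm (hoelder_conjugate r) (EFin \o lam).

(* H_{p',w'}^{t',r'}, with its parameters given as w, p, t and r. *)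
Definition block_space : set (X -> R) :=
  [set f | measurable_fun setT f /\
    exists lam b, block_decomposition f lam b /\ coef_norm lam < +oo].

Definition block_norm (f : X -> R) : \bar R :=
  ereal_inf [set c | exists lam b,
    block_decomposition f lam b /\ c = coef_norm lam].

End spaces.

(* Functionals on a space Y of functions, normed by N up to equality almost
   everywhere; their values outside of Y are irrelevant. *)
Section functionals.
Context {R : realType} {X : Type}.
Variables (Y : set (X -> R)) (N : (X -> R) -> \bar R) (J : (X -> R) -> R).

Definition linear_on : Prop :=
  forall (a : R) f h, Y f -> Y h ->
    J (fun x => a * f x + h x) = a * J f + J h.

Definition bounded_on : Prop :=
  exists C : R, forall f, Y f -> ((`|J f|)%:E <= C%:E * N f)%E.

Definition continuous_on : Prop :=
  forall f, Y f -> forall e : R, 0 < e -> exists2 delta : R, 0 < delta &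
    forall h, Y h -> (N (fun x => (h x - f x)%R) < delta%:E)%E -> `|J h - J f| < e.

Definition in_dual : Prop := linear_on /\ continuous_on.

Definition dual_norm : \bar R :=
  ereal_sup [set (`|J f|)%:E | f in [set f | Y f /\ (N f <= 1)%E]].

End functionals.

Definition pairing {R : realType} {d : measure_display}
    {X : measurableType d} (mu : {measure set X -> \bar R})
    (g f : X -> R) : R := \int[mu]_x (f x * g x).

(* Main.v *)
Require Import Defs.
From HB Require Import structures.
From mathcomp Require Import all_boot all_order all_algebra finmap.
From mathcomp Require Import all_classical all_reals all_analysis.
From mathcomp Require Import measurable_realfun.
From mathcomp Require Import ring lra.

Set Implicit Arguments.
Unset Strict Implicit.
Unset Printing Implicit Defensive.

Import Order.TTheory GRing.Theory Num.Theory.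
Import numFieldNormedType.Exports.

Local Open Scope classical_set_scope.
Local Open Scope ring_scope.

(* Hoelder's inequality on every cube and then over the indices gives
   int |f g| <= ||lam|| ||g|| for every block decomposition of f with
   coefficients lam: this is (i) and one half of the norm identity.
   Conversely let J be a bounded functional.  The block space is an ideal whose
   norm is order continuous: N(1_(D n) f) --> 0 as soon as every point
   eventually leaves the sets D n.  Hence, for a strictly positive phi in the
   block space, A |-> J(1_A phi) is a finite signed measure, absolutely
   continuous with respect to mu; if h is its density, then g := h / phi
   represents J on the bounded multiples of phi.  Testing J on finite sums of
   normalized blocks proportional to sgn(g) |g|^(p - 1) w, truncated to
   |g|^(p - 1) w <= n phi, bounds the norm of g by that of J (duality of l^r'
   and l^r), and order continuity again yields J f = int f g for all f. *)

(** * Sequence spaces *)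

(** Nothing places the constant 1 in the block space, as [mu] is infinite; a positive element [phi]
    takes its place, and dividing by [phi] turns a density of [A |-> J(1_A phi)] into the
    representing function. The price is that the integral formula is known at first only for bounded
    multiples of [phi], so the extremal functions for the norm of [g] have to be truncated relative
    to [phi]. The norm is an infimum over decompositions and has no closed form. Each estimate
    therefore multiplies a given decomposition by a function and redistributes the factor between
    coefficients and blocks. Order continuity rests on the finiteness of both conjugate exponents,
    which includes [r = +oo], where r' = 1: the mass of a single block on [D n] tends to 0 by
    dominated convergence, and a second dominated convergence, over the indices, handles the sum. It
    yields both countable additivity and the passage from truncated to general functions. The
    geometry supplies countably many cubes of positive finite weight, a disjoint generation covering
    almost all of [X], and finitely many cubes of a generation meeting a ball. *)

Lemma powR_div {R : realType} (x y z : R) : 0 <= x -> 0 < y ->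
  (x / y) `^ z = x `^ z / y `^ z.
Proof.
move=> x0 y0; rewrite powRM ?invr_ge0 ?(ltW y0)//; congr (_ * _).
by rewrite -powR_inv1 ?(ltW y0)// -powRrM mulN1r powRN.
Qed.

Lemma le_poweR {R : realType} (z : R) (x y : \bar R) : 0 <= z ->
  (0 <= x)%E -> (x <= y)%E -> (x `^ z <= y `^ z)%E.
Proof.
move=> z0 x0 xy; apply: gt0_ler_poweR => //; rewrite in_itv/= leey andbT//.
exact: le_trans xy.
Qed.

Lemma ereal_ubound_gt0 {R : realType} (x : \bar R) : (x < +oo)%E ->
  exists2 B : R, 0 < B & (x <= B%:E)%E.
Proof.
case: x => [x|//|] _; last by exists 1; rewrite ?leNye.
exists (`|x| + 1); first by rewrite ltr_wpDl.
by rewrite lee_fin (le_trans (ler_norm _))// lerDl.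
Qed.

Lemma cvg_sum_seq {R : realType} {T : Type} (s : seq T) (u : nat -> T -> R)
    (l : T -> R) : (forall i, u n i @[n --> \oo] --> l i) ->
  \sum_(i <- s) u n i @[n --> \oo] --> \sum_(i <- s) l i.
Proof.
move=> ul; elim: s => [|i s IHs].
  by rewrite big_nil; under eq_fun do rewrite big_nil; exact: cvg_cst.
rewrite big_cons; under eq_fun do rewrite big_cons.
by have h := cvgD (ul i) IHs; exact: (h _).
Qed.

Section discrete.
Context {R : realType} {T : choiceType}.
Implicit Types (a : T -> \bar R) (lam : T -> R) (r : \bar R) (q B C : R).

Lemma le_esumZl (k : R) a : 0 <= k -> (forall i, 0 <= a i)%E ->
  (\esum_(i in setT) (k%:E * a i) <= k%:E * \esum_(i in setT) a i)%E.
Proof.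
move=> k0 a0; apply: ge_ereal_sup => _ [F [finF FT] <-].
rewrite -ge0_mule_fsumr//; apply: lee_wpmul2l; first by rewrite lee_fin.
by apply: ereal_sup_ubound; exists F.
Qed.

Lemma lr_norm_fin_le q C a : 0 < q -> 0 <= C ->
  (lr_norm q%:E a <= C%:E)%E =
  (\esum_(i in setT) `|a i| `^ q <= (C `^ q)%:E)%E.
Proof.
move=> q0 C0 /=.
have S0 : (0 <= \esum_(i in setT) `|a i| `^ q)%E.
  by apply: esum_ge0 => i _; exact: poweR_ge0.
apply/idP/idP => [/(@le_poweR _ q)|/(@le_poweR _ q^-1)].
- rewrite -poweRrM mulVf ?gt_eqF// poweRe1// poweR_EFin.
  by apply=> //; rewrite ?poweR_ge0 ?ltW.
- rewrite poweR_EFin -powRrM mulfV ?gt_eqF// powRr1//.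
  by apply=> //; rewrite ?invr_ge0 ltW.
Qed.

(** Covers both ranges of the theorem at once: [r] finite, or [r = +oo] with [q = 1]. The exponent
    [r = 1] is excluded, so that [q] is always a real number. *)
Definition conj_exp r q : Prop := 1 <= q /\
  ((r = +oo%E /\ q = 1) \/
   exists s, [/\ r = s%:E, 1 < s, 1 < q & s^-1 + q^-1 = 1]).

Lemma conj_expP r : (exists2 s, r = s%:E & 1 < s) \/ r = +oo%E ->
  exists2 q, hoelder_conjugate r = q%:E & conj_exp r q.
Proof.
case=> [[s -> s1]|->]; last first.
  by exists 1; rewrite ?hoelder_conjugatey//; split=> //; left.
have s0 : 0 < s by rewrite (lt_trans _ s1).
have s10 : 0 < s - 1 by rewrite subr_gt0.
exists (s / (s - 1)).
  by rewrite /hoelder_conjugate/= gt_eqF ?(lt_trans lte01)// inver subr_eq0 gt_eqF.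
have q1 : 1 < s / (s - 1) by rewrite ltr_pdivlMr// mul1r gtrBl.
split; first exact: ltW.
right; exists s; split=> //; rewrite invf_div; field; rewrite gt_eqF//.
Qed.

(** Young's inequality term by term, after division by the bounds. Positive upper bounds [C] and [B]
    stand for the norms, which may be 0; several later estimates have the same form for this
    reason. *)
Lemma esum_hoelder r q lam a C B : conj_exp r q -> 0 < C -> 0 < B ->
  (forall i, 0 <= a i)%E ->
  (lr_norm q%:E (EFin \o lam) <= C%:E)%E -> (lr_norm r a <= B%:E)%E ->
  (\esum_(i in setT) (`|lam i|%:E * a i) <= (C * B)%:E)%E.
Proof.
move=> [q1 rq] C0 B0 a0.
have q0 : 0 < q by rewrite (lt_le_trans _ q1).
rewrite (lr_norm_fin_le _ q0 (ltW C0)) => lamC aB.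
case: rq => [[rE qE]|[s [rE s1 {}q1 sq]]].
  have aiB i : (a i <= B%:E)%E.
    rewrite (le_trans _ aB)// rE /=; apply: ereal_sup_ubound; exists i => //.
    by rewrite gee0_abs.
  apply: (@le_trans _ _ (\esum_(i in setT) (B%:E * `|lam i|%:E))%E).
    apply: le_esum => i _; by rewrite muleC; apply: lee_wpmul2r.
  apply: (le_trans (le_esumZl (ltW B0) _)) => [i|].
    by rewrite lee_fin.
  rewrite mulrC EFinM; apply: lee_wpmul2l; first by rewrite lee_fin ltW.
  move: lamC; rewrite qE (powRr1 (ltW C0)); apply: le_trans; apply: le_esum => i _.
  by rewrite poweRe1.
have s0 : 0 < s by rewrite (lt_trans _ s1).
move: aB; rewrite rE (lr_norm_fin_le _ s0 (ltW B0)) => aB.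
(* The weights of Young's inequality for [|lam i| / C] and [a i / B], chosen so that [kq * C^q + ks
   * B^s = C * B * (1/q + 1/s) = C * B]. *)
pose kq := C * B / (q * C `^ q); pose ks := C * B / (s * B `^ s).
have Cq : 0 < C `^ q by rewrite powR_gt0.
have Bs : 0 < B `^ s by rewrite powR_gt0.
have kq0 : 0 < kq by rewrite divr_gt0// mulr_gt0.
have ks0 : 0 < ks by rewrite divr_gt0// mulr_gt0.
have young i : (`|lam i|%:E * a i <=
    kq%:E * `|(lam i)%:E| `^ q + ks%:E * `|a i| `^ s)%E.
  case E : (a i) (a0 i) => [x| |]// x0; last first.
    have -> : (`|+oo : \bar R| = +oo)%E by [].
    rewrite poweRyr ?gt_eqF// [X in (_ <= _ + X)%E]gt0_muley ?lte_fin//.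
    by rewrite addey ?leey.
  rewrite !abse_EFin !poweR_EFin -!EFinM -EFinD !lee_fin.
  rewrite lee_fin in x0; rewrite (ger0_norm x0).
  have := @conjugate_powR R _ _ q s (divr_ge0 (normr_ge0 (lam i)) (ltW C0))
    (divr_ge0 x0 (ltW B0)) q0 s0.
  rewrite addrC => /(_ sq); rewrite !powR_div// => H.
  have := ler_wpM2l (ltW (mulr_gt0 C0 B0)) H.
  rewrite (_ : C * B * _ = `|lam i| * x); last first.
    by field; rewrite ?gt_eqF.
  move=> /le_trans; apply; rewrite le_eqVlt; apply/orP; left; apply/eqP.
  by rewrite /kq /ks; field; rewrite ?gt_eqF.
apply: (@le_trans _ _ (\esum_(i in setT) (kq%:E * `|(lam i)%:E| `^ q) +
   \esum_(i in setT) (ks%:E * `|a i| `^ s))%E).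
  rewrite -esumD; first by apply: le_esum => i _; exact: young.
    by move=> i _; rewrite mule_ge0 ?poweR_ge0// lee_fin ltW.
  by move=> i _; rewrite mule_ge0 ?poweR_ge0// lee_fin ltW.
have -> : C * B = kq * C `^ q + ks * B `^ s.
  rewrite /kq /ks -{1}[C * B]mulr1 -sq; field.
  by rewrite !gt_eqF.
rewrite EFinD !EFinM; apply: leeD.
  apply: (le_trans (le_esumZl (ltW kq0) _)) => [i|].
    by rewrite poweR_ge0.
  by apply: lee_wpmul2l => //; rewrite lee_fin ltW.
apply: (le_trans (le_esumZl (ltW ks0) _)) => [i|].
  by rewrite poweR_ge0.
by apply: lee_wpmul2l => //; rewrite lee_fin ltW.
Qed.

(** Finitely supported coefficients suffice to recover the norm, because a sum over [T] is the
    supremum of its finite partial sums. *)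
Lemma lr_norm_converse r q a C : conj_exp r q -> 0 <= C ->
  (forall i, 0 <= a i)%E ->
  (forall (F : {fset T}) lam, (forall i, 0 <= lam i) ->
    (\sum_(i <- F) (lam i)%:E * a i <=
      (C * (\sum_(i <- F) lam i `^ q) `^ q^-1)%:E)%E) ->
  (lr_norm r a <= C%:E)%E.
Proof.
move=> [q1 rq] C0 a0 H.
have q0 : 0 < q by rewrite (lt_le_trans _ q1).
(* A single index with coefficient 1 shows that the [a i], a priori extended reals, are finite; for
   [r = +oo] it is already the claim. *)
have aC i : (a i <= C%:E)%E.
  have := H [fset i]%fset (fun=> 1) (fun=> ler01).
  by rewrite !big_seq_fset1 mul1e !powR1 mulr1.
have afin i : a i \is a fin_num.
  by rewrite ge0_fin_numE// (le_lt_trans (aC i))// ltry.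
case: rq => [[-> qE]|[s [-> s1 {}q1 sq]]].
  by apply: ge_ereal_sup => _ [i _ <-]; rewrite gee0_abs.
have s0 : 0 < s by rewrite (lt_trans _ s1).
rewrite lr_norm_fin_le//; apply: ge_ereal_sup => _ [F [finF _] <-].
rewrite fsbig_finite//=; set G := fset_set F.
pose x i := fine (a i).
have x0 i : 0 <= x i by rewrite fine_ge0.
rewrite (eq_bigr (fun i => (x i `^ s)%:E)); last first.
  by move=> i _; rewrite gee0_abs// -poweR_EFin fineK.
rewrite sumEFin lee_fin.
(* The extremal coefficients: as [(s - 1) * q = s], both sides are expressed by the same sum [S],
   and the test reads [S <= C * S^(1/q)], that is [S^(1/s) <= C] if [S] is not 0. *)
have := H G (fun i => x i `^ (s - 1)) (fun i => powR_ge0 _ _).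
rewrite (eq_bigr (fun i => (x i `^ s)%:E)); last first.
  by move=> i _; rewrite -(fineK (afin i)) -EFinM -/(x i) [in LHS]mulrC mulr_powRB1.
have sq' : (s - 1) * q = s.
  have : s * q * (s^-1 + q^-1) = s * q by rewrite sq mulr1.
  have -> : s * q * (s^-1 + q^-1) = q + s by field; rewrite !gt_eqF.
  by move=> h; rewrite mulrBl -h; ring.
rewrite (eq_bigr (fun i => x i `^ s)); last first.
  by move=> i _; rewrite -powRrM sq'.
rewrite sumEFin lee_fin.
set S := \sum_(i <- G) _ => HS.
have S0 : 0 <= S by apply: sumr_ge0 => i _; exact: powR_ge0.
have [->|Sn0] := eqVneq S 0; first exact: powR_ge0.
have Sp : 0 < S by rewrite lt_neqAle eq_sym Sn0.
have : S `^ s^-1 <= C.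
  have -> : s^-1 = 1 - q^-1 by rewrite -sq addrK.
  rewrite powRB ?Sn0 ?implybT// powRr1// ler_pdivrMr ?powR_gt0//.
move=> /(ge0_ler_powR (ltW s0)); rewrite !nnegrE powR_ge0 => /(_ isT C0).
by rewrite -powRrM mulVf ?gt_eqF// powRr1.
Qed.

Lemma esum_fset_support (F : {fset T}) (u : T -> R) :
  (forall i, i \notin F -> u i = 0) -> (forall i, 0 <= u i) ->
  (\esum_(i in setT) (u i)%:E = (\sum_(i <- F) u i)%:E)%E.
Proof.
move=> uF u0; rewrite -sumEFin.
transitivity (\sum_(i \in [set` F]) (u i)%:E)%E; last first.
  by rewrite fsbig_finite//= set_fsetK.
rewrite -esum_fset//; last by move=> i _; rewrite lee_fin.
rewrite [RHS]esum_mkcond; apply: eq_esum => i _.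
by case: ifPn => //; rewrite notin_setE/= => /negP iF; rewrite uF.
Qed.

(** Dominated convergence for sums: a finite set of indices carries all of the sum of [a] but
    [e / (2 * c)]. Off this set the bound [c] on [th] suffices; on it, finitely many terms tend to
    0. *)
Lemma esum_vanish a (th : nat -> T -> R) (c : R) : (forall i, 0 <= a i)%E ->
  (\esum_(i in setT) a i < +oo)%E -> 0 < c ->
  (forall n i, 0 <= th n i <= c) ->
  (forall i, th n i @[n --> \oo] --> 0) ->
  forall e : R, 0 < e -> \forall n \near \oo,
    (\esum_(i in setT) ((th n i)%:E * a i) < e%:E)%E.
Proof.
move=> a0 afin c0 thc th0 e e0.
have Sfin : (\esum_(i in setT) a i)%E \is a fin_num.
  by rewrite ge0_fin_numE// esum_ge0.
have aifin i : a i \is a fin_num.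
  rewrite ge0_fin_numE// -(gee0_abs (a0 i)).
  apply: (@summable_pinfty _ _ setT a) => //.
  by rewrite /summable; under eq_esum do rewrite gee0_abs//.
have d0 : 0 < e / (2 * c) by rewrite divr_gt0// mulr_gt0.
have [_ [F [finF _] <-] Flt] := ub_ereal_sup_adherent d0 Sfin.
have tail : (\esum_(i in ~` F) a i < (e / (2 * c))%:E)%E.
  move: Flt; rewrite /= -/(esum _ _) (esumID F)// setTI -esum_fset//.
  rewrite setTI => Flt.
  have FS : (\esum_(i in F) a i)%E \is a fin_num.
    rewrite ge0_fin_numE ?esum_ge0//; apply: le_lt_trans afin.
    by rewrite [leRHS](esumID F)// setTI leeDl// esum_ge0.
  by move: Flt; rewrite EFinN lteBlDr// lteD2lE.
have head : \forall n \near \oo,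
    \sum_(i <- fset_set F) th n i * fine (a i) < e / 2.
  have := @cvg_sum_seq R T (fset_set F) (fun n i => th n i * fine (a i))
    (fun=> 0) (fun i => _).
  rewrite big1// => /(_ _)/cvgr_lt; apply; last by rewrite divr_gt0.
  move=> i; have h := cvgM (th0 i) (cvg_cst (fine (a i))).
  by rewrite mul0r in h; exact: (h _ _).
near=> n.
have th0' i : 0 <= th n i by have /andP[] := thc n i.
have pos i : (0 <= (th n i)%:E * a i)%E by rewrite mule_ge0// lee_fin.
rewrite (esumID F)// setTI [e in ltRHS](splitr e) EFinD.
rewrite setTI.
have tl : (\esum_(i in ~` F) ((th n i)%:E * a i) <= (e / 2)%:E)%E.
  apply: (@le_trans _ _ (\esum_(i in ~` F) (c%:E * a i))%E).
    apply: le_esum => i _; apply: lee_wpmul2r => //.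
    by rewrite lee_fin; have /andP[] := thc n i.
  rewrite esum_mkcond.
  apply: (@le_trans _ _
    (\esum_(i in setT) (c%:E * if i \in ~` F then a i else 0))%E).
    by apply: le_esum => i _; case: ifPn => // _; rewrite mule0.
  apply: (le_trans (le_esumZl (ltW c0) _)) => [i|].
    by case: ifPn.
  rewrite -esum_mkcond; apply: (@le_trans _ _ (c%:E * (e / (2 * c))%:E)%E).
    by apply: lee_wpmul2l; [rewrite lee_fin ltW|exact: ltW].
  rewrite -EFinM lee_fin le_eqVlt; apply/orP; left; apply/eqP; field.
  by rewrite gt_eqF.
apply: lte_leD => //.
  by rewrite ge0_fin_numE ?esum_ge0// (le_lt_trans tl)// ltry.
rewrite esum_fset// fsbig_finite//=.
rewrite (eq_bigr (fun i => (th n i * fine (a i))%:E)); last first.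
  by move=> i _; rewrite EFinM fineK.
by rewrite sumEFin lte_fin; near: n.
Unshelve. all: by end_near. Qed.

End discrete.

(** * Integrals *)

Section countable_esum.
Context {R : realType} {d : measure_display} {X : measurableType d}.
Context {T : choiceType} (cT : countable [set: T]).
Variables (mu : {measure set X -> \bar R}) (f : T -> X -> \bar R).
Hypotheses (mf : forall i, measurable_fun setT (f i))
  (f0 : forall i x, (0 <= f i x)%E).

(** The index type is countable but not enumerated. The fibers of an injection into [nat] have at
    most one element and turn a sum over [T] into a series, to which the theorems on measurability
    and integration of series apply. *)
Let fiber (e : T -> nat) n : set T := [set i | e i = n].

Let esum_fibers (e : T -> nat) (a : T -> \bar R) : (forall i, 0 <= a i)%E ->
  (\esum_(i in setT) a i = \sum_(n <oo) \esum_(i in fiber e n) a i)%E.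
Proof.
move=> a0; rewrite -nneseries_sum_bigcup//.
  by congr esum; apply/esym/seteqP; split=> // i _; exists (e i).
by move=> m n _ _ [i [<- <-]].
Qed.

Let fiberP (e : T -> nat) n : {in setT &, injective e} ->
  fiber e n = set0 \/ exists i, fiber e n = [set i].
Proof.
move=> inj; have [[i ein]|nex] := pselect (exists i, e i = n).
  right; exists i; apply/seteqP; split=> [j /= ejn|_ -> //].
  by apply: inj; rewrite ?inE// ejn.
by left; apply/seteqP; split=> // i ein; apply: nex; exists i.
Qed.

Let measurable_fiber (e : T -> nat) n : {in setT &, injective e} ->
  measurable_fun setT (fun x => \esum_(i in fiber e n) f i x)%E.
Proof.
move=> /(fiberP n)[->|[i ->]].
  by under eq_fun do rewrite esum_set0; exact: measurable_cst.
by under eq_fun do rewrite esum_set1//; exact: mf.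
Qed.

Lemma measurable_esum :
  measurable_fun setT (fun x => \esum_(i in setT) f i x)%E.
Proof.
have /countable_injP[e inj] := cT.
under eq_fun do rewrite (esum_fibers e)//.
apply: (@ge0_emeasurable_sum _ _ _ _
    (fun n x => \esum_(i in fiber e n) f i x)%E predT) => [n x _ _|n _].
  exact: esum_ge0.
exact: measurable_fiber.
Qed.

Lemma integral_esum : (\int[mu]_x (\esum_(i in setT) f i x) =
  \esum_(i in setT) \int[mu]_x f i x)%E.
Proof.
have /countable_injP[e inj] := cT.
under eq_integral do rewrite (esum_fibers e)//.
rewrite integral_nneseries//; last by move=> n x _; exact: esum_ge0.
  rewrite (esum_fibers e); last by move=> i; exact: integral_ge0.
  apply: eq_eseriesr => n _.
  have [->|[i ->]] := fiberP n inj.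
    rewrite esum_set0 (eq_integral (cst 0%E)) ?integral0// => x _.
    by rewrite esum_set0.
  rewrite esum_set1 ?integral_ge0//; apply: eq_integral => x _.
  by rewrite esum_set1.
by move=> n; exact: measurable_fiber.
Qed.

End countable_esum.

(** * Hoelder's inequality for a weight and its dual weight *)

Section weighted_hoelder.
Context {R : realType} {d : measure_display} {X : measurableType d}.
Variables (mu : {measure set X -> \bar R}) (w : X -> R) (p q : R).
Hypotheses (p1 : 1 < p) (q1 : 1 < q) (pq : p^-1 + q^-1 = 1)
  (mw : measurable_fun setT w) (w0 : forall x, 0 < w x).
Local Notation v := (dual_weight p w).

Lemma measurable_dual_weight : measurable_fun setT v.
Proof. exact: measurableT_comp (measurable_powR _) mw. Qed.

Lemma dual_weight_gt0 x : 0 < v x.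
Proof. exact: powR_gt0. Qed.

Let p0 : 0 < p. Proof. exact: lt_trans p1. Qed.
Let q0 : 0 < q. Proof. exact: lt_trans q1. Qed.

Lemma conj_expE : (p - 1) * (q - 1) = 1.
Proof.
have : p * q * (p^-1 + q^-1) = p * q by rewrite pq mulr1.
have -> : p * q * (p^-1 + q^-1) = q + p by field; rewrite !gt_eqF.
by move=> h; rewrite mulrBl mulrBr -h; ring.
Qed.

Lemma dual_weightE x : v x = (w x `^ (- p^-1)) `^ q.
Proof.
rewrite /dual_weight -powRrM; congr (_ `^ _).
rewrite mulNr; congr (- _).
have pE : (p - 1) * q = p by have := conj_expE; lra.
by rewrite -[in RHS]pE invfM mulfVK// gt_eqF.
Qed.

(** The unweighted inequality for [b w^(-1/p)] and [1_A g w^(1/p)]: the powers of [w] cancel in the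
    product, and the [q]-th power of [w^(-1/p)] is the dual weight. *)
Lemma weighted_hoelder (A : set X) (b g : X -> R) : measurable A ->
  measurable_fun setT b -> measurable_fun setT g ->
  (forall x, ~ A x -> b x = 0) ->
  (\int[mu]_x `|b x * g x|%:E <=
    (\int[mu]_(x in A) (`|b x| `^ q * v x)%:E) `^ q^-1 *
    (\int[mu]_(x in A) (`|g x| `^ p * w x)%:E) `^ p^-1)%E.
Proof.
move=> mA mb mg b0.
pose f1 x := b x * w x `^ (- p^-1).
pose g1 x := \1_A x * (g x * w x `^ p^-1).
have mf1 : measurable_fun setT f1.
  apply: measurable_funM => //; exact: measurableT_comp (measurable_powR _) mw.
have mg1 : measurable_fun setT g1.
  apply: measurable_funM; first exact: measurable_indic.
  apply: measurable_funM => //; exact: measurableT_comp (measurable_powR _) mw.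
have := hoelder mu mf1 mg1 q0 p0.
rewrite addrC => /(_ pq).
rewrite Lnorm1 unlock (eq_integral (fun x => `|b x * g x|%:E)); last first.
  move=> x _; rewrite /= /f1 /g1 indicE.
  have [xA|xA] := boolP (x \in A); last first.
    by rewrite mul0r mulr0 b0 ?mul0r//; move: xA; rewrite notin_setE.
  rewrite mul1r powRN; congr (`| _ |%:E).
  have : w x `^ p^-1 != 0 by rewrite gt_eqF// powR_gt0.
  by move=> wn0; field.
move=> /le_trans; apply; apply: lee_pmul; rewrite ?poweR_ge0//.
- rewrite le_eqVlt; apply/orP; left; apply/eqP; rewrite [in RHS]integral_mkcond.
  congr (_ `^ _)%E; apply: eq_integral => x _; rewrite /patch /=.
  case: ifPn => xA; last first.
    rewrite /f1 b0 ?mul0r ?normr0 ?powR0 ?gt_eqF//.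
    by move: xA; rewrite notin_setE.
  rewrite /f1 normrM powRM//.
  by rewrite (ger0_norm (powR_ge0 _ _)) -dual_weightE.
- rewrite le_eqVlt; apply/orP; left; apply/eqP; rewrite [in RHS]integral_mkcond.
  congr (_ `^ _)%E; apply: eq_integral => x _; rewrite /patch /g1 /= indicE.
  case: ifPn => xA; last first.
    by rewrite mul0r normr0 powR0 ?gt_eqF.
  rewrite mul1r normrM powRM//.
  by rewrite (ger0_norm (powR_ge0 _ _)) -powRrM mulVf ?gt_eqF// powRr1// ltW.
Qed.

End weighted_hoelder.

(** * Block decompositions *)

Section signed_esum.
Context {R : realType} {T : choiceType}.
Implicit Types (u a : T -> \bar R).

Lemma esumZl (k : R) a : 0 <= k -> (forall i, 0 <= a i)%E ->
  (\esum_(i in setT) (k%:E * a i) = k%:E * \esum_(i in setT) a i)%E.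
Proof.
rewrite le_eqVlt => /predU1P[<- a0|k0 a0].
  by rewrite mul0e esum1// => i _; rewrite mul0e.
apply/eqP; rewrite eq_le le_esumZl ?(ltW k0)//= -lee_pdivlMl//.
have k1 : 0 <= k^-1 by rewrite invr_ge0 ltW.
have ka i : (0 <= k%:E * a i)%E by rewrite mule_ge0// lee_fin ltW.
apply: le_trans (le_esumZl k1 ka); apply: le_esum => i _.
by rewrite muleA -EFinM mulVf ?gt_eqF// mul1e.
Qed.

(** For negative [c] the positive and negative parts trade places; summability makes both sums
    finite, so that their difference can be reversed. *)
Lemma signed_esumZ (u : T -> \bar R) (c : R) (y : \bar R) :
  summable setT u -> y = (esum setT u^\+ - esum setT u^\-)%E ->
  let v := fun i => (c%:E * u i)%E in
  summable setT v /\ (c%:E * y = esum setT v^\+ - esum setT v^\-)%E.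
Proof.
move=> su yE v.
have sv : summable setT v.
  rewrite /summable; under eq_esum do rewrite abseM abse_EFin.
  rewrite esumZl//; apply: lte_mul_pinfty => //; by rewrite lee_fin.
split=> //.
have fp : (esum setT u^\+)%E \is a fin_num.
  have := summable_funepos su; rewrite summableE.
  by under eq_esum do rewrite gee0_abs//.
have fn : (esum setT u^\-)%E \is a fin_num.
  have := summable_funeneg su; rewrite summableE.
  by under eq_esum do rewrite gee0_abs//.
rewrite yE /v; have [c0|c0] := leP 0 c.
  by rewrite ge0_funeposM// ge0_funenegM// !esumZl// muleBr// fin_num_adde_defr.
rewrite le0_funeposM ?le0_funenegM ?(ltW c0)//.
under [X in _ = (X - _)%E]eq_esum do rewrite -EFinN.
under [X in _ = (_ - X)%E]eq_esum do rewrite -EFinN.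
rewrite !esumZl ?oppr_ge0 ?(ltW c0)// muleBr// ?fin_num_adde_defr//.
by rewrite EFinN !mulNe oppeK addeC.
Qed.

Lemma abse_signed_esum u :
  (`|esum setT u^\+ - esum setT u^\-| <= \esum_(i in setT) `|u i|)%E.
Proof.
apply: (le_trans (lee_abs_sub _ _)).
rewrite !gee0_abs ?esum_ge0// -esumD//.
by apply: le_esum => i _; rewrite -/((abse \o u) i) fune_abse.
Qed.

Lemma signed_esum_fset (F : {fset T}) (u : T -> R) :
  (forall i, i \notin F -> u i = 0) ->
  let v := EFin \o u in
  summable setT v /\
  ((\sum_(i <- F) u i)%:E = esum setT v^\+ - esum setT v^\-)%E.
Proof.
move=> uF v; split.
  rewrite /summable /v /=.
  rewrite (@esum_fset_support _ _ F (fun i => `|u i|)) ?ltry//.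
  by move=> i iF; rewrite uF// normr0.
have vp : v^\+%E = EFin \o (fun i => Num.max (u i) 0).
  by apply/funext => i; rewrite funeposE /v /= EFin_max.
have vn : v^\-%E = EFin \o (fun i => Num.max (- u i) 0).
  by apply/funext => i; rewrite funenegE /v /= EFin_max.
rewrite vp vn !(@esum_fset_support _ _ F).
- rewrite -EFinB; congr EFin; rewrite -sumrB; apply: eq_bigr => i _.
  have [ui|ui] := leP 0 (u i); first by rewrite max_r ?subr0 ?oppr_le0.
  by rewrite max_l ?sub0r ?opprK// oppr_ge0 ltW.
- by move=> i iF; rewrite uF// oppr0 maxxx.
- by move=> i; rewrite le_max lexx orbT.
- by move=> i iF; rewrite uF// maxxx.
- by move=> i; rewrite le_max lexx orbT.
Qed.

End signed_esum.

(** The analytic input of the duality, separated from the geometry. Here [w] is positive at every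
    point, so that powers of [w] can be divided by everywhere and the dual weight is positive
    too. *)
Record admissible {R : realType} {d : measure_display} {X : measurableType d}
    (mu : {measure set X -> \bar R}) (I : int -> choiceType)
    (Q : forall k : int, I k -> set X) (w : X -> R) (p : R) (r : \bar R)
    : Prop := Admissible {
  adm_p : 1 < p ;
  adm_r : (exists2 s, r = s%:E & 1 < s) \/ r = +oo%E ;
  adm_mw : measurable_fun setT w ;
  adm_w0 : forall x, 0 < w x ;
  adm_countable : countable [set: {k : int & I k}] ;
  adm_mQ : forall i : {k : int & I k}, measurable (Q _ (projT2 i)) ;
  adm_wQ : forall i : {k : int & I k},
    (0 < wmeas mu w (Q _ (projT2 i)) < +oo)%E ;
  adm_vQ : forall i : {k : int & I k},
    (\int[mu]_(x in Q _ (projT2 i)) (dual_weight p w x)%:E < +oo)%E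
}.

Section blocks.
Context {R : realType} {d : measure_display} {X : measurableType d}.
Variables (mu : {measure set X -> \bar R}) (I : int -> choiceType).
Variables (Q : forall k : int, I k -> set X) (w : X -> R) (p t : R).
Variables (r : \bar R).
Hypothesis adm : admissible mu Q w p r.
Local Notation index := {k : int & I k}.
Local Notation cube i := (Q (projT2 i)).
Local Notation q := (fine (hoelder_conjugate p%:E)).
Local Notation r' := (fine (hoelder_conjugate r)).
Local Notation v := (dual_weight p w).
Local Notation W i := (fine (wmeas mu w (cube i) `^ (t^-1 - p^-1))).
Local Notation BMN := (BM_norm mu Q w p t r).
Local Notation H := (block_space mu Q w p t r).
Local Notation N := (block_norm mu Q w p t r).
Local Notation decomp := (block_decomposition mu Q w p t).

Lemma conj_expp : 1 < q /\ p^-1 + q^-1 = 1.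
Proof.
have [q' -> /= [_ [[]//|[s [[->] _ ? ?]]]]] : exists2 q,
  hoelder_conjugate p%:E = q%:E & conj_exp p%:E q.
  by apply: conj_expP; left; exists p => //; exact: adm_p adm.
by [].
Qed.

Lemma conj_expr : hoelder_conjugate r = r'%:E /\ conj_exp r r'.
Proof. by have [q' -> /=] := conj_expP (adm_r adm). Qed.

Let q1 : 1 < q. Proof. by have [] := conj_expp. Qed.
Let q0 : 0 < q. Proof. exact: lt_trans q1. Qed.
Let pq : p^-1 + q^-1 = 1. Proof. by have [] := conj_expp. Qed.
Let p1 : 1 < p. Proof. exact: adm_p adm. Qed.
Let r'1 : 1 <= r'. Proof. by have [_ []] := conj_expr. Qed.
Let r'0 : 0 < r'. Proof. exact: lt_le_trans r'1. Qed.

Lemma cube_weightE (i : index) :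
  (wmeas mu w (cube i) `^ (t^-1 - p^-1) = (W i)%:E)%E.
Proof.
have /andP[_ wQ] := adm_wQ adm i.
by rewrite fineK// fin_num_poweR// ge0_fin_numE// integral_ge0// => x _;
  rewrite lee_fin ltW// (adm_w0 adm).
Qed.

Lemma cube_weight_gt0 (i : index) : 0 < W i.
Proof.
have /andP[wQ _] := adm_wQ adm i.
by rewrite -lte_fin -cube_weightE poweR_gt0.
Qed.

Lemma BM_normE g : BMN g = lr_norm r (fun i : index => (W i)%:E *
    (\int[mu]_(x in cube i) (`|g x| `^ p * w x)%:E) `^ p^-1)%E.
Proof.
by rewrite /BM_norm; congr lr_norm; apply/funext => i; rewrite cube_weightE.
Qed.

Lemma coef_normE (lam : index -> R) :
  coef_norm r lam = lr_norm r'%:E (EFin \o lam).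
Proof. by rewrite /coef_norm (proj1 conj_expr). Qed.

Lemma coef_norm_le (lam : index -> R) C : 0 <= C ->
  (coef_norm r lam <= C%:E)%E =
  (\esum_(i in setT) (`|lam i| `^ r')%:E <= (C `^ r')%:E)%E.
Proof. by move=> C0; rewrite coef_normE lr_norm_fin_le. Qed.

Lemma coef_norm_ge0 (lam : index -> R) : (0 <= coef_norm r lam)%E.
Proof. by rewrite coef_normE poweR_ge0. Qed.

Lemma block_norm_ge0 f : (0 <= N f)%E.
Proof.
by apply: le_ereal_inf_tmp => _ [lam [b [_ ->]]]; exact: coef_norm_ge0.
Qed.

Lemma block_norm_le f (lam : index -> R) b : decomp f lam b ->
  (N f <= coef_norm r lam)%E.
Proof.
move=> fd; apply: ge_ereal_inf; exists (coef_norm r lam) => //.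
by exists lam, b.
Qed.

Lemma pairing_le f lam b g B C : measurable_fun setT f ->
  measurable_fun setT g -> decomp f lam b -> 0 < B -> 0 < C ->
  (coef_norm r lam <= C%:E)%E -> (BMN g <= B%:E)%E ->
  (\int[mu]_x `|f x * g x|%:E <= (C * B)%:E)%E.
Proof.
move=> mf mg [hb fE] B0 C0 lamC gB.
pose h i x := (`|lam i * b i x * g x|%:E)%E.
have mh i : measurable_fun setT (h i).
  have [mb _ _] := hb i.
  apply/measurable_EFinP/measurableT_comp => //.
  by apply: measurable_funM => //; apply: measurable_funM.
have h0 i x : (0 <= h i x)%E by rewrite lee_fin.
apply: (@le_trans _ _ (\int[mu]_x \esum_(i in setT) h i x)%E).
  apply: ae_ge0_le_integral => //.
  - by apply/measurable_EFinP/measurableT_comp => //; apply: measurable_funM.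
  - by move=> x _; apply: esum_ge0.
  - exact: (measurable_esum (adm_countable adm)).
  - apply: filterS fE => x [_ fx] _.
    rewrite normrM EFinM -[X in (X * _)%E]abse_EFin fx muleC.
    apply: (le_trans (lee_wpmul2l _ (abse_signed_esum _))) => //.
    rewrite -esumZl//; apply: le_esum => i _.
    by rewrite abse_EFin -EFinM /h lee_fin mulrC -normrM.
rewrite (integral_esum (adm_countable adm))//.
pose a (i : index) := ((W i)%:E *
  (\int[mu]_(x in cube i) (`|g x| `^ p * w x)%:E) `^ p^-1)%E.
have a0 i : (0 <= a i)%E.
  by rewrite mule_ge0 ?poweR_ge0// lee_fin ltW// cube_weight_gt0.
rewrite coef_normE in lamC; rewrite BM_normE in gB.
apply: le_trans (esum_hoelder (proj2 conj_expr) C0 B0 a0 lamC gB).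
apply: le_esum => i _; have [mb b0 bW] := hb i.
under eq_integral do rewrite /h -mulrA normrM EFinM.
rewrite ge0_integralZl//; last first.
  by apply/measurable_EFinP/measurableT_comp => //; apply: measurable_funM.
apply: lee_wpmul2l => //.
apply: (le_trans (weighted_hoelder mu p1 q1 pq (adm_mw adm) (adm_w0 adm)
  (adm_mQ adm i) mb mg b0)).
by apply: lee_wpmul2r; rewrite ?poweR_ge0// -cube_weightE.
Qed.

(** At a fixed point [m x] is a scalar, so the series is multiplied termwise there. Only the
    products [lam' i * b' i] are prescribed: how the factor is shared between coefficient and block
    is left to the application. *)
Lemma decomposition_mul f lam b (m : X -> R) lam' b' : decomp f lam b ->
  (forall i, is_block mu w p t (cube i) (b' i)) ->
  (forall i x, lam' i * b' i x = m x * (lam i * b i x)) ->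
  decomp (fun x => m x * f x) lam' b'.
Proof.
move=> [_ fE] hb' mE; split=> //.
apply: filterS fE => x [su fx].
have := signed_esumZ (m x) su fx.
have -> : (fun i => (lam' i * b' i x)%:E) =
    (fun i => (m x)%:E * (lam i * b i x)%:E)%E.
  by apply/funext => i; rewrite mE EFinM.
by rewrite EFinM.
Qed.

End blocks.

Section vanishing.
Context {R : realType}.

Lemma powR_vanish (u : nat -> R) (z : R) : 0 < z -> (forall n, 0 <= u n) ->
  u n @[n --> \oo] --> (0 : R) -> u n `^ z @[n --> \oo] --> (0 : R).
Proof.
move=> z0 u0 ucv; apply/cvgrPdist_lt => e e0.
have e'0 : 0 < e `^ z^-1 by rewrite powR_gt0.
have /cvgr_lt/(_ _ e'0) : u n @[n --> \oo] --> (0 : R) by [].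
apply: filterS => n une; rewrite sub0r normrN ger0_norm ?powR_ge0//.
have := gt0_ltr_powR z0 (u0 n : u n \in Num.nneg) (ltW e'0 : _ \in Num.nneg) une.
by rewrite -powRrM mulVf ?gt_eqF// powRr1// ltW.
Qed.

Lemma integral_indic_vanish {d : measure_display} {X : measurableType d}
    (mu : {measure set X -> \bar R}) (A : set X) (h : X -> R)
    (D : nat -> set X) : measurable A -> measurable_fun setT h ->
  (forall x, 0 <= h x) -> (\int[mu]_(x in A) (h x)%:E < +oo)%E ->
  (forall n, measurable (D n)) ->
  (forall x, \forall n \near \oo, ~ D n x) ->
  fine (\int[mu]_(x in A) (\1_(D n) x * h x)%:E)%E @[n --> \oo] --> (0 : R).
Proof.
move=> mA mh h0 hfin mD hD.
have mhA : measurable_fun A (EFin \o h).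
  by apply/measurable_EFinP; exact: measurable_funTS.
apply/fine_cvg.
have [|||||_ _] := @dominated_convergence _ _ _ mu A mA
  (fun n x => (\1_(D n) x * h x)%:E) (cst 0%E) (EFin \o h).
- move=> n; apply/measurable_EFinP/measurable_funM; last exact: measurable_funTS.
  exact: measurable_indic.
- exact: measurable_cst.
- apply: aeW => x _; apply: cvg_near_cst; apply: filterS (hD x) => n Dnx.
  by rewrite indicE memNset// mul0r.
- apply/integrableP; split=> //; apply: le_lt_trans hfin.
  by under eq_integral do rewrite /= ger0_norm//.
- apply: aeW => x n _; rewrite lee_fin ger0_norm ?mulr_ge0//.
  by rewrite indicE; case: (x \in D n); rewrite ?mul1r ?mul0r.
by rewrite integral_cst// mul0e; exact.
Qed.

End vanishing.

(** * The block space: ideal property, order continuity of the norm, a positive element *)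

Section block_space.
Context {R : realType} {d : measure_display} {X : measurableType d}.
Variables (mu : {measure set X -> \bar R}) (I : int -> choiceType).
Variables (Q : forall k : int, I k -> set X) (w : X -> R) (p t : R).
Variables (r : \bar R).
Hypothesis adm : admissible mu Q w p r.
Local Notation index := {k : int & I k}.
Local Notation cube i := (Q (projT2 i)).
Local Notation q := (fine (hoelder_conjugate p%:E)).
Local Notation r' := (fine (hoelder_conjugate r)).
Local Notation v := (dual_weight p w).
Local Notation W i := (fine (wmeas mu w (cube i) `^ (t^-1 - p^-1))).
Local Notation BMN := (BM_norm mu Q w p t r).
Local Notation H := (block_space mu Q w p t r).
Local Notation N := (block_norm mu Q w p t r).
Local Notation decomp := (block_decomposition mu Q w p t).

Let q1 : 1 < q. Proof. by have [] := conj_expp adm. Qed.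
Let q0 : 0 < q. Proof. exact: lt_trans q1. Qed.
Let r'1 : 1 <= r'. Proof. by have [_ []] := conj_expr adm. Qed.
Let r'0 : 0 < r'. Proof. exact: lt_le_trans r'1. Qed.
Let mv : measurable_fun setT v.
Proof. exact: measurable_dual_weight (adm_mw adm). Qed.
Let v0 x : 0 < v x. Proof. exact: dual_weight_gt0 (adm_w0 adm) _. Qed.
Let W0 (i : index) : 0 < W i. Proof. exact: (cube_weight_gt0 t adm). Qed.

Let measurable_density (b : X -> R) : measurable_fun setT b ->
  measurable_fun setT (fun x => `|b x| `^ q * v x).
Proof.
move=> mb; apply: measurable_funM => //.
apply: (measurableT_comp (measurable_powR q)); exact: measurableT_comp.
Qed.

Let density_ge0 (b : X -> R) x : 0 <= `|b x| `^ q * v x.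
Proof. by rewrite mulr_ge0 ?powR_ge0// ltW. Qed.

Lemma is_blockP (i : index) (b : X -> R) : measurable_fun setT b ->
  (forall x, ~ cube i x -> b x = 0) ->
  (\int[mu]_(x in cube i) (`|b x| `^ q * v x)%:E <= (W i `^ q)%:E)%E <->
  is_block mu w p t (cube i) b.
Proof.
move=> mb b0.
set S := (\int[mu]_(x in cube i) _)%E.
have S0 : (0 <= S)%E by apply: integral_ge0 => x _; rewrite lee_fin.
split=> [SW|[_ _]].
  split=> //; rewrite -/S (cube_weightE t adm).
  have -> : (W i)%:E = ((W i `^ q)%:E `^ q^-1)%E.
    by rewrite poweR_EFin -powRrM mulfV ?gt_eqF// powRr1 ?(ltW (W0 i)).
  by apply: le_poweR => //; rewrite invr_ge0 ltW.
rewrite -/S (cube_weightE t adm) => /(le_poweR (ltW q0)).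
rewrite -poweRrM mulVf ?gt_eqF// poweRe1// poweR_EFin; apply.
exact: poweR_ge0.
Qed.

Lemma coef_normZ (lam : index -> R) (c : R) : 0 < c ->
  (coef_norm r (fun i => c * lam i)%R = c%:E * coef_norm r lam)%E.
Proof.
move=> c0; rewrite !(coef_normE adm) /=.
have -> : (\esum_(i in setT) `|(c * lam i)%:E| `^ r' =
    (c `^ r')%:E * \esum_(i in setT) `|(lam i)%:E| `^ r')%E.
  rewrite -esumZl ?powR_ge0//; last by move=> i; exact: poweR_ge0.
  apply: eq_esum => i _.
  rewrite !abse_EFin !poweR_EFin -EFinM normrM powRM//.
  by rewrite (gtr0_norm c0).
rewrite poweRM ?lee_fin ?powR_ge0//; last first.
  by apply: esum_ge0 => i _; exact: poweR_ge0.
by rewrite poweR_EFin -powRrM mulfV ?gt_eqF// powRr1// ltW.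
Qed.

(** Multiplication by [m / M] keeps a block a block, and the factor [M] goes to the coefficients. As
    this applies to every decomposition of [f], it bounds the infimum. *)
Lemma block_space_mul f (m : X -> R) (M : R) : H f -> measurable_fun setT m ->
  0 < M -> (forall x, `|m x| <= M) ->
  H (fun x => m x * f x) /\ (N (fun x => m x * f x)%R <= M%:E * N f)%E.
Proof.
move=> Hf mm M0 mM.
have dec lam b : decomp f lam b -> decomp (fun x => m x * f x)
    (fun i => M * lam i) (fun i x => M^-1 * (m x * b i x)).
  move=> fd; apply: (decomposition_mul fd) => [i|i x]; last first.
    by field; rewrite gt_eqF.
  have [+ _] := fd => /(_ i) bi; have [mb b0 _] := bi.
  apply/is_blockP.
  - by apply: measurable_funM => //; apply: measurable_funM.
  - by move=> x xQ; rewrite b0// !mulr0.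
  apply: le_trans (proj2 (is_blockP mb b0) bi).
  apply: ge0_le_integral => //.
  - exact: adm_mQ adm i.
  - by move=> x _; rewrite lee_fin mulr_ge0 ?powR_ge0 ?(ltW (v0 x)).
  - apply/measurable_EFinP/measurable_funTS/measurable_density.
    by apply: measurable_funM => //; apply: measurable_funM.
  - exact/measurable_EFinP/measurable_funTS/measurable_density.
  move=> x _; rewrite lee_fin ler_wpM2r ?(ltW (v0 x))//.
  apply: ge0_ler_powR; rewrite ?nnegrE ?(ltW q0)//.
  rewrite !normrM mulrA ler_piMl// normfV (gtr0_norm M0).
  by rewrite ler_pdivrMl// mulr1.
have [mf [lam [b [fd lamfin]]]] := Hf.
split.
  split; first exact: measurable_funM.
  exists (fun i => M * lam i), (fun i x => M^-1 * (m x * b i x)).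
  split; first exact: dec.
  by rewrite coef_normZ// lte_mul_pinfty// lee_fin ltW.
rewrite -lee_pdivrMl//; apply: le_ereal_inf_tmp => _ [lam' [b' [fd' ->]]].
rewrite lee_pdivrMl// -coef_normZ//.
exact: block_norm_le (dec _ _ fd').
Qed.

Lemma coef_norm_fin (lam : index -> R) : (coef_norm r lam < +oo)%E ->
  (\esum_(i in setT) (`|lam i| `^ r')%:E < +oo)%E.
Proof.
by rewrite (coef_normE adm) => /lty_poweRy; apply; rewrite invr_neq0// gt_eqF.
Qed.

(** Order continuity. One decomposition of [f] is kept throughout: [1_(D n) b i] is a block times
    [th n i], which is essentially its norm relative to the block bound. This factor is moved into
    the coefficients; it is bounded by 2 and tends to 0 for each [i], so [esum_vanish] applies to
    the [r']-th powers. *)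
Lemma block_norm_vanish f (D : nat -> set X) : H f ->
  (forall n, measurable (D n)) ->
  (forall x, \forall n \near \oo, ~ D n x) ->
  forall e : R, 0 < e ->
  \forall n \near \oo, (N (fun x => \1_(D n) x * f x)%R <= e%:E)%E.
Proof.
move=> [mf [lam [b [fd lamfin]]]] mD hD e e0.
have [hb _] := fd.
have mb i : measurable_fun setT (b i) by have [] := hb i.
have b0 i x : ~ cube i x -> b i x = 0 by have [_ + _] := hb i; exact.
pose G n i := (\int[mu]_(x in cube i)
  (\1_(D n) x * (`|b i x| `^ q * v x))%:E)%E.
have G0 n i : (0 <= G n i)%E.
  by apply: integral_ge0 => x _; rewrite lee_fin mulr_ge0.
have GW n i : (G n i <= (W i `^ q)%:E)%E.
  apply: le_trans (proj2 (is_blockP (mb i) (b0 i)) (hb i)).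
  apply: ge0_le_integral => //.
  - exact: adm_mQ adm i.
  - by move=> x _; rewrite lee_fin mulr_ge0.
  - apply/measurable_EFinP/measurable_funM.
      exact: measurable_indic.
    exact/measurable_funTS/measurable_density.
  - exact/measurable_EFinP/measurable_funTS/measurable_density.
  by move=> x _; rewrite lee_fin ler_piMl.
have Gfin n i : G n i \is a fin_num.
  by rewrite ge0_fin_numE// (le_lt_trans (GW n i))// ltry.
(* 1 / (n + 1) keeps the factor positive when b i vanishes on D n. *)
pose th n i := fine (G n i) `^ q^-1 / W i + n.+1%:R^-1.
have th0 n i : 0 < th n i.
  by rewrite ltr_wpDl ?invr_gt0 ?ltr0n// divr_ge0 ?powR_ge0 ?(ltW (W0 i)).
have th2 n i : th n i <= 2.
  rewrite -[2]/(1 + 1); apply: lerD; last by rewrite invf_le1 ?ltr0n ?ler1n.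
  rewrite ler_pdivrMr// mul1r.
  have -> : W i = (W i `^ q) `^ q^-1.
    by rewrite -powRrM mulfV ?gt_eqF// powRr1 ?(ltW (W0 i)).
  apply: ge0_ler_powR; rewrite ?nnegrE ?powR_ge0 ?fine_ge0 ?invr_ge0 ?(ltW q0)//.
  by rewrite -lee_fin fineK.
have thcv i : th n i @[n --> \oo] --> (0 : R).
  have Gcv : fine (G n i) `^ q^-1 @[n --> \oo] --> (0 : R).
    apply: powR_vanish => [|n|]; [by rewrite invr_gt0|exact: fine_ge0|].
    apply: integral_indic_vanish => //.
    - exact: adm_mQ adm i.
    - exact: measurable_density.
    - apply: le_lt_trans (proj2 (is_blockP (mb i) (b0 i)) (hb i)) _.
      exact: ltry.
  have := cvgD (cvgM Gcv (cvg_cst (W i)^-1)) (@cvg_harmonic R).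
  by rewrite mul0r addr0 => h; exact: (h _ _ _).
have dec n : decomp (fun x => \1_(D n) x * f x)%R
    (fun i => th n i * lam i) (fun i x => (th n i)^-1 * (\1_(D n) x * b i x)).
  apply: (decomposition_mul fd) => [i|i x]; last first.
    by field; rewrite gt_eqF.
  apply/is_blockP.
  - by apply: measurable_funM => //; apply: measurable_funM.
  - by move=> x xQ; rewrite b0// !mulr0.
  rewrite (eq_integral (fun x => ((th n i)^-1 `^ q)%:E *
      (\1_(D n) x * (`|b i x| `^ q * v x))%:E)%E); last first.
    move=> x _; rewrite -EFinM; congr EFin.
    rewrite !normrM !powRM//.
    have /gtr0_norm -> : 0 < (th n i)^-1 by rewrite invr_gt0.
    rewrite -!mulrA; congr (_ * _).
    congr (_ * _); rewrite indicE; case: (x \in D n); first by rewrite normr1 powR1.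
    by rewrite normr0 powR0 ?gt_eqF.
  rewrite ge0_integralZl_EFin ?powR_ge0//; last 3 first.
  - exact: adm_mQ adm i.
  - by move=> x _; rewrite lee_fin mulr_ge0.
  - apply/measurable_EFinP/measurable_funM.
      exact: measurable_indic.
    exact/measurable_funTS/measurable_density.
  rewrite -/(G n i) -(fineK (Gfin n i)) -EFinM lee_fin.
  rewrite -powR_inv1 ?(ltW (th0 n i))// powRAC powR_inv1 ?powR_ge0//.
  rewrite ler_pdivrMl ?powR_gt0// -powRM ?(ltW (W0 i)) ?(ltW (th0 n i))//.
  have -> : fine (G n i) = (fine (G n i) `^ q^-1) `^ q.
    by rewrite -powRrM mulVf ?gt_eqF// powRr1// fine_ge0.
  apply: ge0_ler_powR; rewrite ?nnegrE ?powR_ge0 ?(ltW q0)//.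
    by rewrite mulr_ge0 ?(ltW (W0 i)) ?(ltW (th0 n i)).
  rewrite mulrDl divfK ?gt_eqF// lerDl mulr_ge0 ?(ltW (W0 i))//.
have : \forall n \near \oo, (\esum_(i in setT)
    ((th n i `^ r')%:E * (`|lam i| `^ r')%:E) < (e `^ r')%:E)%E.
  apply: (@esum_vanish _ _ (fun i => (`|lam i| `^ r')%:E)
      (fun n i => th n i `^ r') (2 `^ r')) => [i|||n i|i|].
  - by rewrite lee_fin powR_ge0.
  - exact: coef_norm_fin.
  - by rewrite powR_gt0.
  - rewrite powR_ge0 /=; apply: ge0_ler_powR => //.
    + exact: ltW.
    + by rewrite nnegrE ltW.
    + by rewrite nnegrE.
  - by apply: powR_vanish => // n; exact: ltW.
  - by rewrite powR_gt0.
apply: filterS => n lt; apply: (le_trans (block_norm_le r (dec n))).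
rewrite (coef_norm_le adm) ?(ltW e0)//; apply: le_trans (ltW lt).
apply: le_esum => i _; rewrite -EFinM lee_fin normrM (gtr0_norm (th0 n i)).
by rewrite powRM// ltW.
Qed.

(** A sum of multiples of the indicators of all cubes of generation 0, with coefficients
    [2^-(e i + 1)] for an injection [e] of the indices into [nat]. By disjointness at most one term
    is nonzero at each point. *)
Lemma block_space_gt0 :
  (forall a b : I 0, Q a `&` Q b !=set0 -> a = b) ->
  {ae mu, forall x, exists a : I 0, Q a x} ->
  exists2 phi, H phi & forall x, 0 < phi x.
Proof.
move=> disj cover.
have /countable_injP[e inj] := adm_countable adm.
pose V (i : index) := fine (\int[mu]_(x in cube i) (v x)%:E)%E.
have intv0 (i : index) : (0 <= \int[mu]_(x in cube i) (v x)%:E)%E.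
  by apply: integral_ge0 => x _; rewrite lee_fin ltW.
have V0 i : 0 <= V i by exact: fine_ge0.
(* Makes [b i] a block, since [V i / (1 + V i) <= 1]; the summand 1 keeps the denominator positive
   without a lower bound on [V i]. *)
pose al i := W i / (1 + V i) `^ q^-1.
have V10 i : 0 < 1 + V i by rewrite ltr_wpDr.
have al0 i : 0 < al i by rewrite divr_gt0// powR_gt0.
pose lam (i : index) : R := if projT1 i == 0 then 1 / (2 ^ (e i).+1)%:R else 0.
have lam0 i : 0 <= lam i by rewrite /lam; case: ifPn.
pose b (i : index) x : R := al i * \1_(cube i) x.
have mb i : measurable_fun setT (b i).
  by apply: measurable_funM => //; apply: measurable_indic; exact: adm_mQ adm i.
have b0 i x : ~ cube i x -> b i x = 0.
  by move=> xi; rewrite /b indicE memNset// mulr0.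
have hb i : is_block mu w p t (cube i) (b i).
  apply/is_blockP => //; first exact: b0.
  rewrite (eq_integral (fun x => (al i `^ q)%:E * (v x)%:E)%E); last first.
    move=> x xi; rewrite /b indicE xi mulr1 EFinM.
    by rewrite gtr0_norm.
  rewrite ge0_integralZl_EFin ?powR_ge0//; last 3 first.
  - exact: adm_mQ adm i.
  - by move=> x _; rewrite lee_fin ltW.
  - exact/measurable_EFinP/measurable_funTS.
  have -> : (\int[mu]_(x in cube i) (v x)%:E)%E = (V i)%:E.
    by rewrite fineK// ge0_fin_numE//; exact: adm_vQ adm i.
  rewrite -EFinM lee_fin /al powR_div ?(ltW (W0 i)) ?powR_gt0//.
  rewrite -powRrM mulVf ?gt_eqF// powRr1 ?(ltW (V10 i))//.
  rewrite mulrAC ler_pdivrMr// ler_wpM2l ?powR_ge0// lerDr//.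
pose u x i := lam i * b i x.
have u0 x i : 0 <= u x i.
  by rewrite mulr_ge0// mulr_ge0// ltW.
pose E x := (\esum_(i in setT) (u x i)%:E)%E.
have mE : measurable_fun setT E.
  apply: (measurable_esum (adm_countable adm)) => i; last first.
    by move=> x; rewrite lee_fin.
  apply/measurable_EFinP; exact: measurable_funM.
have E0 x : (0 <= E x)%E by apply: esum_ge0 => i _; rewrite lee_fin.
have single x (a : I 0) i : Q a x ->
    i \notin [fset existT (fun k => I k) 0 a]%fset -> u x i = 0.
  move=> xa; rewrite inE /u /lam /b; case: i => k c /=.
  case: ifPn => [/eqP k0|]; last by rewrite mul0r.
  subst k => ca; rewrite indicE memNset ?mulr0// => xc.
  by move: ca; rewrite (disj c a) ?eqxx//; exists x.
have EE x (a : I 0) : Q a x -> E x = (u x (existT (fun k => I k) 0 a))%:E.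
  move=> xa; rewrite /E (esum_fset_support (single x a ^~ xa))//.
  by rewrite big_seq_fset1.
(* [Z] is the complement of the cubes of generation 0, hence null. Adding its indicator makes [phi]
   positive everywhere and leaves the decomposition valid almost everywhere. *)
pose Z := E @^-1` [set 0%E].
have mZ : measurable Z.
  by rewrite -[Z]setTI; apply: mE => //; exact: emeasurable_set1.
pose phi x := fine (E x) + \1_Z x.
have uQ x (a : I 0) : Q a x -> 0 < u x (existT (fun k => I k) 0 a).
  move=> xa; rewrite /u /lam /b /= mulr_gt0 ?divr_gt0 ?ltr0n ?expn_gt0//.
  by rewrite mulr_gt0// indicE mem_set.
exists phi; last first.
  move=> x; rewrite /phi; have [[a xa]|nx] := pselect (exists a : I 0, Q a x).
    by rewrite ltr_pwDl// (EE _ _ xa) /= uQ.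
  rewrite indicE mem_set ?ltr_wpDl// ?fine_ge0//.
  rewrite /Z /= /E esum1// => -[k c] _; rewrite /u /lam /b /=.
  case: ifPn => [/eqP k0|]; last by rewrite mul0r.
  subst k; rewrite indicE memNset ?mulr0// => xc.
  by apply: nx; exists c.
split.
  apply: measurable_funD; last exact: measurable_indic.
  exact: measurableT_comp mE.
exists lam, b; split.
  split=> //; apply: filterS cover => x [a xa].
  have [su sE] := signed_esum_fset (fun i => @single x a i xa).
  split=> //; rewrite -[RHS]sE big_seq_fset1 /phi (EE _ _ xa) /=.
  rewrite indicE memNset ?addr0//.
  by rewrite /Z /= (EE _ _ xa) => -[]; apply/eqP; rewrite gt_eqF// uQ.
rewrite (coef_normE adm); apply: poweR_lty.
apply: (@le_lt_trans _ _ 1%E); last exact: ltry.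
(* As the coefficients are at most 1 and [r' >= 1], their [r']-th powers do not exceed them, and a
   geometric series bounds the sum. *)
apply: (@le_trans _ _ (\esum_(i in setT) (1 / (2 ^ (e i).+1)%:R)%:E)%E).
  apply: le_esum => i _; rewrite abse_EFin ger0_norm// poweR_EFin lee_fin /lam.
  case: ifPn => _; last by rewrite powR0 ?gt_eqF// divr_ge0.
  apply: ge1r_powR => //; rewrite divr_gt0 ?ltr0n ?expn_gt0//=.
  by rewrite ler_pdivrMr ?ltr0n ?expn_gt0// mul1r ler1n expn_gt0.
rewrite -(@esum_image _ _ _ setT e (fun n => (1 / (2 ^ n.+1)%:R)%:E)); last first.
  by move=> i j _ _; apply: inj; rewrite inE.
apply: le_trans (@epsilon_trick0 R 1 xpredT ler01).
rewrite nneseries_esumT; last by move=> n; rewrite lee_fin divr_ge0.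
by rewrite esum_mkcond; apply: le_esum => n _; case: ifPn.
Qed.

End block_space.

(** * Bounded functionals on the block space *)

(** Packs a set function that is only defined inside a proof into the charge structure. *)
Lemma charge_of {d : measure_display} {X : measurableType d} {R : realType}
    (f : set X -> \bar R) : f set0 = 0%E ->
  (forall A, measurable A -> f A \is a fin_num) -> semi_sigma_additive f ->
  exists nu : {charge set X -> \bar R}, forall A, nu A = f A.
Proof.
move=> h0 hf hs.
pose m := isCharge.Build d X R f h0 hf hs.
pose nu : {charge set X -> \bar R} := HB.pack f m.
by exists nu.
Qed.

Section functionals.
Context {R : realType} {d : measure_display} {X : measurableType d}.
Variables (mu : {measure set X -> \bar R}) (I : int -> choiceType).
Variables (Q : forall k : int, I k -> set X) (w : X -> R) (p t : R).
Variables (r : \bar R).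
Hypothesis adm : admissible mu Q w p r.
Local Notation index := {k : int & I k}.
Local Notation cube i := (Q (projT2 i)).
Local Notation H := (block_space mu Q w p t r).
Local Notation N := (block_norm mu Q w p t r).
Local Notation decomp := (block_decomposition mu Q w p t).
Variable phi : X -> R.
Hypotheses (Hphi : H phi) (phi0 : forall x, 0 < phi x).
Variable J : (X -> R) -> R.
Hypothesis dualJ : in_dual H N J.

(** Decompositions see [f] only up to null sets, so zero coefficients and zero blocks decompose it.
    This is what makes functionals ignore null sets. *)
Lemma block_space_ae0 (f : X -> R) : measurable_fun setT f ->
  {ae mu, forall x, f x = 0} -> H f /\ (N f <= 0%:E)%E.
Proof.
move=> mf f0.
have dec : decomp f (fun=> 0) (fun _ _ => 0).
  split=> [i|].
    split=> //.
    rewrite integral0_eq => [|x _]; last first.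
      rewrite normr0 powR0 ?mul0r// gt_eqF// (lt_trans ltr01)//.
      exact: (conj_expp adm).1.
    rewrite poweR0r ?poweR_ge0// invr_neq0// gt_eqF// (lt_trans ltr01)//.
    exact: (conj_expp adm).1.
  apply: filterS f0 => x -> /=; rewrite mul0r.
  have [su sE] := @signed_esum_fset R index fset0 (fun=> 0) (fun _ _ => erefl).
  by rewrite big_seq_fset0 in sE; split.
have r0 : 0 < fine (hoelder_conjugate r).
  by rewrite (lt_le_trans ltr01)//; have [_ []] := conj_expr adm.
have c0 : (@coef_norm R I r (fun=> 0%R) <= 0%:E)%E.
  rewrite (coef_norm_le adm)// esum1 ?lee_fin ?powR_ge0// => i _.
  by rewrite normr0 powR0// gt_eqF.
split; last exact: le_trans (block_norm_le r dec) c0.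
split=> //; exists (fun=> 0), (fun _ _ => 0); split=> //.
exact: le_lt_trans c0 (ltry _).
Qed.

Lemma block_space0 : H (fun=> 0) /\ (N (fun=> 0%R) <= 0%:E)%E.
Proof. by apply: block_space_ae0; [exact: measurable_cst|exact: aeW]. Qed.

Lemma block_space_scale (c : R) f : 0 < c -> H f ->
  H (fun x => c * f x) /\ (N (fun x => c * f x)%R <= c%:E * N f)%E.
Proof.
move=> c0 Hf; apply: (block_space_mul adm Hf _ c0) => [|x].
  exact: measurable_cst.
by rewrite gtr0_norm.
Qed.

Lemma block_space_indic f (A : set X) : H f -> measurable A ->
  H (fun x => \1_A x * f x).
Proof.
move=> Hf mA; have [|//] := block_space_mul adm Hf (measurable_indic mA) ltr01.
by move=> x; rewrite indicE; case: (x \in A); rewrite ?normr1 ?normr0.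
Qed.

Lemma functional0 : J (fun=> 0) = 0.
Proof.
have [H0 _] := block_space0; have [lin _] := dualJ.
have := lin 1 _ _ H0 H0.
have -> : (fun _ : X => 1 * 0 + 0 : R) = fun=> 0.
  by apply/funext => x; rewrite mulr0 addr0.
by rewrite mul1r => /eqP; rewrite eq_sym -subr_eq0 addrK => /eqP.
Qed.

Lemma functionalZ (a : R) f : H f -> J (fun x => a * f x) = a * J f.
Proof.
move=> Hf; have [lin _] := dualJ.
have [H0 _] := block_space0.
have := lin a _ _ Hf H0; rewrite functional0 addr0 => <-.
by congr J; apply/funext => x; rewrite addr0.
Qed.

Lemma functionalD f h : H f -> H h -> J (fun x => f x + h x) = J f + J h.
Proof.
move=> Hf Hh; have [lin _] := dualJ; have := lin 1 _ _ Hf Hh.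
by rewrite mul1r => <-; congr J; apply/funext => x; rewrite mul1r.
Qed.

(** Continuity at 0 with tolerance 1 gives a radius [e]; multiplication by [e / 2] moves the unit
    ball strictly inside it. *)
Lemma functional_locally_bounded :
  exists2 C : R, 0 < C & forall f, H f -> (N f <= 1)%E -> `|J f| <= C.
Proof.
have [_ cont] := dualJ.
have [H0 _] := block_space0.
have [e e0 he] := cont _ H0 _ ltr01.
exists (2 / e); first by rewrite divr_gt0.
move=> f Hf Nf.
have e20 : 0 < e / 2 by rewrite divr_gt0.
have [Hef Nef] := block_space_scale e20 Hf.
have := he _ Hef.
have -> : (fun x => e / 2 * f x - 0) = fun x => e / 2 * f x.
  by apply/funext => x; rewrite subr0.
rewrite functional0 subr0 functionalZ// normrM gtr0_norm//.
have small : (N (fun x => e / 2 * f x)%R < e%:E)%E.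
  apply: (le_lt_trans Nef); apply: (@le_lt_trans _ _ ((e / 2)%:E * 1)%E).
    by rewrite lee_wpmul2l// lee_fin ltW.
  by rewrite mule1 lte_fin ltr_pdivrMr// ltr_pMr// ltr1n.
move=> /(_ small) /ltW; rewrite -ler_pdivlMl//.
by rewrite mulr1 invf_div.
Qed.

Lemma dual_norm_fin : dual_norm H N J \is a fin_num.
Proof.
have [C C0 hC] := functional_locally_bounded.
have [H0 N0] := block_space0.
rewrite ge0_fin_numE.
  apply: (@le_lt_trans _ _ C%:E); last exact: ltry.
  by apply: ge_ereal_sup => _ [f [Hf Nf] <-]; rewrite lee_fin hC.
apply: (@le_trans _ _ (`|J (fun=> 0)|)%:E); first by rewrite lee_fin.
apply: ereal_sup_ubound; exists (fun=> 0) => //; split=> //.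
by apply: (le_trans N0); rewrite lee_fin.
Qed.

Local Notation K := (fine (dual_norm H N J)).

Lemma dual_norm_ge0 : 0 <= K.
Proof.
have [H0 N0] := block_space0.
rewrite -lee_fin fineK ?dual_norm_fin//.
apply: (@le_trans _ _ (`|J (fun=> 0)|)%:E); first by rewrite lee_fin.
apply: ereal_sup_ubound; exists (fun=> 0) => //; split=> //.
by apply: (le_trans N0); rewrite lee_fin.
Qed.

(** Rescaling by [C^-1] instead of the inverse of [N f], which may be 0. *)
Lemma functional_le f (C : R) : H f -> 0 < C -> (N f <= C%:E)%E ->
  `|J f| <= K * C.
Proof.
move=> Hf C0 NC.
have C1 : 0 < C^-1 by rewrite invr_gt0.
have [Hcf Ncf] := block_space_scale C1 Hf.
have : (`|J (fun x => C^-1 * f x)|%:E <= dual_norm H N J)%E.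
  apply: ereal_sup_ubound; exists (fun x => C^-1 * f x) => //; split=> //.
  by apply: (le_trans Ncf); rewrite lee_pdivrMl// mule1.
rewrite functionalZ// normrM gtr0_norm// -(fineK dual_norm_fin) lee_fin.
by rewrite ler_pdivrMl// mulrC.
Qed.

Lemma functional_vanish f (D : nat -> set X) : H f ->
  (forall n, measurable (D n)) -> (forall x, \forall n \near \oo, ~ D n x) ->
  J (fun x => \1_(D n) x * f x) @[n --> \oo] --> (0 : R).
Proof.
move=> Hf mD hD; apply/cvgrPdist_le => e e0.
have K1 : 0 < K + 1 by rewrite ltr_wpDl// dual_norm_ge0.
have eK : 0 < e / (K + 1) by rewrite divr_gt0.
have := block_norm_vanish adm Hf mD hD eK.
apply: filterS => n Nn; rewrite sub0r normrN.
have /le_trans := functional_le (block_space_indic Hf (mD n)) eK Nn; apply.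
by rewrite mulrCA ger_pMr// ler_pdivrMr// mul1r lerDl.
Qed.

(** For disjoint sets [F i] with union [U], additivity of [J] writes a partial sum as the value on
    [U] minus the value on the remainder [D n]. A point of [F i] lies outside [D n] as soon as
    [n > i], so the remainder tends to 0 by order continuity. *)
Lemma functional_charge : exists nu : {charge set X -> \bar R},
  forall A, measurable A -> nu A = (J (fun x => \1_A x * phi x))%:E.
Proof.
pose f (A : set X) := (J (fun x => \1_A x * phi x))%:E.
have [|//||nu nuE] := @charge_of _ X R f; last by exists nu => A _; rewrite nuE.
- rewrite /f (_ : (fun x => _) = fun=> 0) ?functional0//.
  by apply/funext => x; rewrite indic0 mul0r.
move=> F mF tF mUF.
pose U := \bigcup_n F n.
pose D n := U `\` \big[setU/set0]_(i < n) F i.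
have mD n : measurable (D n).
  by apply: measurableD => //; apply: bigsetU_measurable.
have sumE n : \sum_(0 <= i < n) f (F i) =
    (J (fun x => \1_U x * phi x) - J (fun x => \1_(D n) x * phi x))%:E.
  elim: n => [|n IHn].
    by rewrite big_geq// /D big_ord0 setD0 subrr.
  rewrite big_nat_recr//= IHn /f -EFinD; congr EFin.
  have -> : J (fun x => \1_(D n) x * phi x) =
      J (fun x => \1_(F n) x * phi x) + J (fun x => \1_(D n.+1) x * phi x).
    rewrite -functionalD; [|exact: block_space_indic..].
    congr J; apply/funext => x; rewrite -mulrDl; congr (_ * _).
    have DF : D n = F n `|` D n.+1.
      rewrite /D big_ord_recr/=; apply/seteqP; split=> [y [Uy yn]|y].
        by have [Fy|Fy] := pselect (F n y); [left|right; split=> // -[]].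
      case=> [Fy|[Uy /not_orP[yn _]]] //; split; first by exists n.
      rewrite -bigcup_mkord => -[i /= ni Fiy].
      have := tF i n Logic.I Logic.I; move=> /(_ (ex_intro _ y (conj Fiy Fy))).
      by move=> ein; rewrite ein ltnn in ni.
    rewrite DF !indicE in_setU.
    have [xF|] := boolP (x \in F n); last by rewrite add0r.
    rewrite memNset ?addr0// => -[_]; apply; rewrite big_ord_recr /=; right.
    exact: set_mem.
  by ring.
have hD x : \forall n \near \oo, ~ D n x.
  have [[i _ Fix]|Ux] := pselect (U x); last by apply: nearW => n [].
  exists i.+1 => // n /= ni [_]; apply; rewrite -bigcup_mkord.
  by exists i.
rewrite (_ : (fun n => _) = fun n => (J (fun x => \1_U x * phi x) -
    J (fun x => \1_(D n) x * phi x))%:E); last by apply/funext => n; exact: sumE.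
apply/cvg_EFin; first by apply: nearW.
have := cvgB (cvg_cst (J (fun x => \1_U x * phi x)))
  (functional_vanish Hphi mD hD).
by rewrite subr0 => h; exact: (h _).
Qed.

Let phi_mul (s : X -> R) : measurable_fun setT s -> (forall x, 0 <= s x <= 1) ->
  H (fun x => s x * phi x) /\ (N (fun x => s x * phi x)%R <= N phi)%E.
Proof.
move=> ms s01; rewrite -[leRHS]mul1e; apply: (block_space_mul adm) => // x.
by have /andP[s0 s1] := s01 x; rewrite ger0_norm.
Qed.

(* Halving: s = 1_{s >= 1/2} / 2 + s' / 2 with 0 <= s' <= 1 halves the
   defect |J (s phi) - int s h| at each step. *)
Lemma functional_bounded_mul h (s : X -> R) :
  mu.-integrable setT (EFin \o h) ->
  (forall A, measurable A ->
    J (fun x => \1_A x * phi x) = \int[mu]_x (\1_A x * h x)) ->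
  measurable_fun setT s -> (forall x, 0 <= s x <= 1) ->
  J (fun x => s x * phi x) = \int[mu]_x (s x * h x).
Proof.
move=> ih JA ms s01.
have mh : measurable_fun setT h.
  by apply/measurable_EFinP; exact: measurable_int ih.
have Nphi : (N phi < +oo)%E.
  have [_ [lam [b [dec]]]] := Hphi; apply: le_lt_trans.
  exact: block_norm_le dec.
pose C := fine (N phi) + 1.
have C0 : 0 < C by rewrite ltr_wpDl// fine_ge0// (block_norm_ge0 t adm).
have NC : (N phi <= C%:E)%E.
  rewrite -[leLHS]fineK ?ge0_fin_numE ?(block_norm_ge0 t adm)//.
  by rewrite lee_fin lerDl.
pose L := \int[mu]_x `|h x|.
have isf (f : X -> R) : measurable_fun setT f -> (forall x, 0 <= f x <= 1) ->
    mu.-integrable setT (EFin \o (fun x => f x * h x)).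
  move=> mf f01; apply: le_integrable ih => //.
    by apply/measurable_EFinP; exact: measurable_funM.
  move=> x _; rewrite /= lee_fin normrM ler_piMl//.
  by have /andP[f0 f1] := f01 x; rewrite ger0_norm.
pose D f := `|J (fun x => f x * phi x) - \int[mu]_x (f x * h x)|.
have step n : forall f : X -> R,
    measurable_fun setT f -> (forall x, 0 <= f x <= 1) ->
    D f <= (K * C + L) / (2 ^ n)%:R.
  elim: n => [f mf f01|n IHn f mf f01].
    rewrite expn0 divr1 /D; apply: (le_trans (ler_normB _ _)); apply: lerD.
      have [Hf Nf] := phi_mul mf f01.
      exact: functional_le Hf C0 (le_trans Nf NC).
    apply: (le_trans (le_normr_Rintegral _ (isf f mf f01))) => //.
    apply: le_Rintegral => //.
    - have := integrable_abse (isf f mf f01); exact.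
    - have := integrable_abse ih; exact.
    - move=> x _; rewrite normrM ler_piMl//.
      by have /andP[f0 f1] := f01 x; rewrite ger0_norm.
  pose A := [set x | 2^-1 <= f x].
  have mA : measurable A.
    rewrite -[A]setTI (_ : A = f @^-1` `[2^-1, +oo[).
      by apply: mf => //; exact: measurable_itv.
    by apply/seteqP; split=> x; rewrite /A /= in_itv/= andbT.
  pose f' x := 2 * f x - \1_A x.
  have mf' : measurable_fun setT f'.
    apply: measurable_funB; last exact: measurable_indic.
    exact: measurable_funM.
  have f'01 x : 0 <= f' x <= 1.
    have /andP[f0 f1] := f01 x; rewrite /f' indicE.
    have [/set_mem|/negP] := boolP (x \in A).
      by rewrite /A /= => ?; lra.
    by rewrite inE /A /= => /negP; rewrite -ltNge => ?; lra.
  have A01 x : 0 <= (\1_A x : R) <= 1.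
    by rewrite indicE; case: (x \in A); rewrite ?lexx ?ler01.
  have Jf : J (fun x => f x * phi x) = 2^-1 * J (fun x => \1_A x * phi x) +
      2^-1 * J (fun x => f' x * phi x).
    have [HA _] := phi_mul (measurable_indic mA) A01.
    have [Hf' _] := phi_mul mf' f'01.
    have h2 : 0 < 2^-1 :> R by rewrite invr_gt0.
    rewrite -!functionalZ// -functionalD.
    - by congr J; apply/funext => x; rewrite /f'; field.
    - exact: (block_space_scale h2 HA).1.
    - exact: (block_space_scale h2 Hf').1.
  have If : \int[mu]_x (f x * h x) = 2^-1 * \int[mu]_x (\1_A x * h x) +
      2^-1 * \int[mu]_x (f' x * h x).
    have iA := isf _ (measurable_indic mA) A01; have if' := isf _ mf' f'01.
    rewrite -!RintegralZl// -RintegralD//.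
    - by apply: eq_Rintegral => x _; rewrite /f'; field.
    - have := integrableZl measurableT 2^-1 iA; exact.
    - have := integrableZl measurableT 2^-1 if'; exact.
  rewrite /D Jf If JA// [X in X - _]addrC addrKA -mulrBr.
  rewrite normrM ger0_norm ?invr_ge0//.
  have := IHn f' mf' f'01; rewrite /D expnS natrM invfM => H1.
  by rewrite mulrCA ler_wpM2l// ?invr_ge0.
apply/eqP; rewrite -subr_eq0 -normr_le0; apply/ler_addgt0Pl => e e0.
have M0 : 0 <= K * C + L.
  by rewrite addr_ge0// ?mulr_ge0 ?dual_norm_ge0 ?(ltW C0)// Rintegral_ge0.
have [n ltn] : exists n : nat, (K * C + L) / e < n%:R.
  by exists (Num.trunc ((K * C + L) / e)).+1; exact: truncnS_gt.
rewrite addr0; apply: (le_trans (step n s ms s01)).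
rewrite ler_pdivrMr ?ltr0n ?expn_gt0// -ler_pdivrMl// mulrC.
by apply: (le_trans (ltW ltn)); rewrite ler_nat ltnW// ltn_expl.
Qed.

End functionals.

(** On a null set [A] the function [1_A phi] vanishes almost everywhere, so it has norm 0 and [J]
    kills it. This is the absolute continuity that Radon-Nikodym requires; the theorem also asks for
    a sigma-finite [mu]. *)
Lemma functional_density {R : realType} {d : measure_display}
    {X : measurableType d} (mu : {sigma_finite_measure set X -> \bar R})
    (I : int -> choiceType) (Q : forall k : int, I k -> set X) (w : X -> R)
    (p t : R) (r : \bar R) (phi : X -> R) (J : (X -> R) -> R) :
  admissible mu Q w p r -> block_space mu Q w p t r phi ->
  in_dual (block_space mu Q w p t r) (block_norm mu Q w p t r) J ->
  exists2 h : X -> R, mu.-integrable setT (EFin \o h) &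
  forall A, measurable A ->
    J (fun x => \1_A x * phi x) = \int[mu]_x (\1_A x * h x).
Proof.
move=> adm Hphi dualJ.
pose K := fine (dual_norm (block_space mu Q w p t r)
  (block_norm mu Q w p t r) J).
have [nu nuE] := functional_charge adm Hphi dualJ.
have numu : nu `<< mu.
  apply/null_content_dominatesP => A mA muA0; rewrite nuE//.
  have mAphi : measurable_fun setT (fun x => \1_A x * phi x).
    by apply: measurable_funM; [exact: measurable_indic|case: Hphi].
  have A0 : {ae mu, forall x, \1_A x * phi x = 0}.
    exists A; split=> // x /=; apply: contra_notP => nAx.
    by rewrite indicE memNset// mul0r.
  have [HA NA] := block_space_ae0 t adm mAphi A0.
  have [->//|Jn0] := eqVneq (J (fun x => \1_A x * phi x)) 0.
  have K1 : 0 < K + 1 by rewrite ltr_wpDl// (dual_norm_ge0 adm dualJ).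
  (* Norm 0 allows any positive bound in [functional_le]. With [a] the absolute value of the
     functional, this one yields [a <= K / (2 * (K + 1)) * a], impossible for [a > 0]. *)
  have C0 : 0 < `|J (fun x => \1_A x * phi x)| / (K + 1) / 2.
    by apply: divr_gt0 => //; apply: divr_gt0 => //; rewrite normr_gt0.
  have := functional_le adm dualJ HA C0 (le_trans NA _).
  rewrite lee_fin ltW// => /(_ isT); rewrite -/K.
  set a := `|_|; have a0 : 0 < a by rewrite normr_gt0.
  rewrite -mulrA mulrCA -[X in X <= _]mulr1 ler_pM2l//.
  have : K * (1 / (K + 1) / 2) < 1.
    rewrite -mulrA mul1r -invfM ltr_pdivrMr ?mulr_gt0// mul1r.
    by have := dual_norm_ge0 adm dualJ; rewrite -/K; lra.
  by rewrite mul1r -invfM => /lt_le_trans h /h; rewrite ltxx.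
pose f := Radon_Nikodym nu mu.
have ff x : f x \is a fin_num by exact: Radon_Nikodym_fin_num.
have fE : EFin \o (fine \o f) = f by apply/funext => x; rewrite /= fineK.
exists (fine \o f); first by rewrite fE; exact: Radon_Nikodym_integrable.
move=> A mA; have := nuE A mA; rewrite (Radon_Nikodym_integral numu mA).
rewrite integral_mkcond -/f => fA.
rewrite /Rintegral (eq_integral (f \_ A)) => [|x _]; first by rewrite fA.
rewrite epatch_indic /= EFinM fineK// muleC//.
Qed.

(** * Representation of functionals *)

(** At a positive limit the power function is derivable, hence continuous; the limit 0 is handled by
    [powR_vanish]. *)
Lemma powR_cvg {R : realType} (u : nat -> R) (l z : R) : 0 < z ->
  (forall n, 0 <= u n) -> u n @[n --> \oo] --> l ->
  u n `^ z @[n --> \oo] --> l `^ z.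
Proof.
move=> z0 u0 ul.
have : 0 <= l by apply: (cvgr_to_ge ul); exact: nearW.
rewrite le_eqVlt => /predU1P[l0|l0].
  rewrite -l0 powR0 ?gt_eqF//; apply: powR_vanish => //.
  by rewrite l0.
apply: (@cvg_comp _ _ _ u (fun x => x `^ z) _ (nbhs l)) => //.
have : derivable (fun x => x `^ z) l 1.
  by apply: derivable_powR; rewrite in_itv/= andbT.
by move/derivable1_diffP/differentiable_continuous.
Qed.

Section pairing.
Context {R : realType} {d : measure_display} {X : measurableType d}.
Variables (mu : {measure set X -> \bar R}) (I : int -> choiceType).
Variables (Q : forall k : int, I k -> set X) (w : X -> R) (p t : R).
Variables (r : \bar R).
Hypothesis adm : admissible mu Q w p r.
Local Notation BMN := (BM_norm mu Q w p t r).
Local Notation H := (block_space mu Q w p t r).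
Local Notation N := (block_norm mu Q w p t r).

(** The strict inequality provides a decomposition whose coefficients have norm below [C], since the
    infimum in the norm of [f] need not be attained. *)
Lemma pairing_lt f g (B C : R) : H f -> measurable_fun setT g -> 0 < B ->
  (BMN g <= B%:E)%E -> (N f < C%:E)%E ->
  (\int[mu]_x `|f x * g x|%:E <= (C * B)%:E)%E.
Proof.
move=> [mf _] mg B0 gB /ereal_inf_lt[_ [lam [b [fd ->]]] lamC].
have C0 : 0 < C.
  by rewrite -lte_fin (le_lt_trans _ lamC)// (coef_norm_ge0 adm).
exact: (pairing_le adm mf mg fd B0 C0 (ltW lamC) gB).
Qed.

Lemma block_norm_fin f : H f -> (N f < +oo)%E.
Proof.
move=> [_ [lam [b [dec]]]]; apply: le_lt_trans.
exact: block_norm_le dec.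
Qed.

Lemma pairing_integrable f g : H f -> measurable_fun setT g ->
  (BMN g < +oo)%E -> mu.-integrable setT (fun x => (f x * g x)%:E).
Proof.
move=> Hf mg gfin; apply/integrableP; split.
  by apply/measurable_EFinP; apply: measurable_funM => //; case: Hf.
have [B B0 gB] := ereal_ubound_gt0 gfin.
have := @pairing_lt f g B (fine (N f) + 1) Hf mg B0 gB.
move=> /(_ _)/le_lt_trans; apply; last exact: ltry.
rewrite -[ltLHS]fineK ?ge0_fin_numE ?(block_norm_ge0 t adm) ?block_norm_fin//.
by rewrite lte_fin ltrDl.
Qed.

Lemma pairing_le_norm f g (B C : R) : H f -> measurable_fun setT g -> 0 < B ->
  (BMN g <= B%:E)%E -> (N f < C%:E)%E -> `|pairing mu g f| <= C * B.
Proof.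
move=> Hf mg B0 gB NC.
have ig : mu.-integrable setT (fun x => (f x * g x)%:E).
  by apply: pairing_integrable => //; apply: le_lt_trans gB (ltry _).
rewrite /pairing -lee_fin EFin_normr_Rintegral//.
apply: le_trans (pairing_lt Hf mg B0 gB NC).
by apply: (le_trans (le_abse_integral _ _ _)) => //; exact: measurable_int ig.
Qed.

End pairing.

Section representation.
Context {R : realType} {d : measure_display} {X : measurableType d}.
Variables (mu : {measure set X -> \bar R}) (I : int -> choiceType).
Variables (Q : forall k : int, I k -> set X) (w : X -> R) (p t : R).
Variables (r : \bar R).
Hypothesis adm : admissible mu Q w p r.
Local Notation index := {k : int & I k}.
Local Notation cube i := (Q (projT2 i)).
Local Notation q := (fine (hoelder_conjugate p%:E)).
Local Notation r' := (fine (hoelder_conjugate r)).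
Local Notation v := (dual_weight p w).
Local Notation W i := (fine (wmeas mu w (cube i) `^ (t^-1 - p^-1))).
Local Notation BMN := (BM_norm mu Q w p t r).
Local Notation H := (block_space mu Q w p t r).
Local Notation N := (block_norm mu Q w p t r).
Local Notation decomp := (block_decomposition mu Q w p t).
Variable phi : X -> R.
Hypotheses (Hphi : H phi) (phi0 : forall x, 0 < phi x).
Variable J : (X -> R) -> R.
Hypothesis dualJ : in_dual H N J.
Local Notation K := (fine (dual_norm H N J)).
Variable h : X -> R.
Hypotheses (ih : mu.-integrable setT (EFin \o h))
  (Jh : forall A, measurable A ->
     J (fun x => \1_A x * phi x) = \int[mu]_x (\1_A x * h x)).

Let q1 : 1 < q. Proof. by have [] := conj_expp adm. Qed.
Let q0 : 0 < q. Proof. exact: lt_trans q1. Qed.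
Let pq : p^-1 + q^-1 = 1. Proof. by have [] := conj_expp adm. Qed.
Let p1 : 1 < p. Proof. exact: adm_p adm. Qed.
Let p0 : 0 < p. Proof. exact: lt_trans p1. Qed.
Let r'1 : 1 <= r'. Proof. by have [_ []] := conj_expr adm. Qed.
Let r'0 : 0 < r'. Proof. exact: lt_le_trans r'1. Qed.
Let W0 (i : index) : 0 < W i. Proof. exact: (cube_weight_gt0 t adm). Qed.
Let mphi : measurable_fun setT phi. Proof. by case: Hphi. Qed.
Let mh : measurable_fun setT h.
Proof. by apply/measurable_EFinP; exact: measurable_int ih. Qed.
Let K0 : 0 <= K. Proof. exact: (dual_norm_ge0 adm dualJ). Qed.

Definition density_quotient (x : X) := h x / phi x.
Local Notation g := density_quotient.

Let mphiV : measurable_fun setT (fun x => (phi x)^-1).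
Proof.
rewrite (_ : (fun _ => _) = fun x => phi x `^ (-1)).
  exact: measurableT_comp (measurable_powR _) mphi.
by apply/funext => x; rewrite powR_inv1// ltW.
Qed.

Lemma measurable_density_quotient : measurable_fun setT g.
Proof. exact: measurable_funM. Qed.

Lemma functional_le_ge0 f (C : R) : H f -> 0 <= C -> (N f <= C%:E)%E ->
  `|J f| <= K * C.
Proof.
move=> Hf C0 NC; apply/ler_addgt0Pl => e e0.
have K1 : 0 < K + 1 by rewrite ltr_wpDl.
have C1 : 0 < C + e / (K + 1) by rewrite ltr_wpDl// divr_gt0.
have := functional_le adm dualJ Hf C1.
move=> /(_ _)/le_trans; apply.
  by apply: (le_trans NC); rewrite lee_fin lerDl divr_ge0// ltW.
rewrite mulrDr addrC lerD2r mulrCA ger_pMr// ler_pdivrMr// mul1r lerDl//.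
Qed.

Lemma functional_mul_density (s : X -> R) (M : R) : measurable_fun setT s ->
  0 < M -> (forall x, `|s x| <= M) ->
  J (fun x => s x * phi x) = \int[mu]_x (s x * h x).
Proof.
move=> ms M0 sM.
(* Affine change to values in [0, 1], where the halving argument applies; then [s = 2 M s' - M], and
   linearity gives the formula for [s]. *)
pose s' x := (s x / M + 1) / 2.
have ms' : measurable_fun setT s'.
  by apply: measurable_funM => //; apply: measurable_funD => //;
    exact: measurable_funM.
have s'01 x : 0 <= s' x <= 1.
  have := sM x; rewrite ler_norml => /andP[s1 s2].
  have h1 : -1 <= s x / M by rewrite ler_pdivlMr// mulN1r.
  have h2 : s x / M <= 1 by rewrite ler_pdivrMr// mul1r.
  by rewrite /s'; lra.
have ms1 : measurable_fun setT (fun _ : X => 1 : R) by exact: measurable_cst.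
have Js' := functional_bounded_mul adm Hphi dualJ ih Jh ms' s'01.
have J1 := functional_bounded_mul adm Hphi dualJ ih Jh ms1
  (fun _ => introT andP (conj ler01 (lexx _))).
have Hs' : H (fun x => s' x * phi x).
  have [|//] := block_space_mul adm Hphi ms' ltr01.
  by move=> x; have /andP[? ?] := s'01 x; rewrite ger0_norm.
have is' : mu.-integrable setT (EFin \o (fun x => s' x * h x)).
  apply: le_integrable ih => //.
    by apply/measurable_EFinP; exact: measurable_funM.
  move=> x _; rewrite /= lee_fin normrM ler_piMl//.
  by have /andP[f0 f1] := s'01 x; rewrite ger0_norm.
have M20 : 0 < 2 * M by rewrite mulr_gt0.
have [Hs'' _] := block_space_scale adm M20 Hs'.
have HM : H (fun x => - M * (1 * phi x)).
  have := block_space_mul adm Hphi (m := fun=> - M) (M := M).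
  move=> /(_ (measurable_cst _) M0) [x|HM _]; first by rewrite normrN gtr0_norm.
  by under [X in H X]eq_fun do rewrite mul1r.
have -> : (fun x => s x * phi x) =
    fun x => 2 * M * (s' x * phi x) + (- M * (1 * phi x)).
  by apply/funext => x; rewrite /s'; field; rewrite gt_eqF.
rewrite (functionalD dualJ Hs'' HM) (functionalZ adm dualJ)//.
rewrite (functionalZ adm dualJ); last first.
  by under eq_fun do rewrite mul1r.
rewrite Js' J1 -!RintegralZl//; last first.
  by under eq_fun do rewrite mul1r.
rewrite -RintegralD//.
- by apply: eq_Rintegral => x _; rewrite /s'; field; rewrite gt_eqF.
- have := integrableZl measurableT (2 * M) is'; exact.
- have := integrableZl measurableT (- M) ih.
  by apply: eq_integrable => // x _; rewrite /= mul1r.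
Qed.

Let F x := `|g x| `^ p * w x.
Let E n := [set x | `|g x| `^ (p - 1) * w x / phi x <= n%:R].
Let G n (i : index) := (\int[mu]_(x in cube i) (\1_(E n) x * F x)%:E)%E.
(* sgn(g) |g|^(p - 1) *)
Let sgpow x := g x * `|g x| `^ (p - 1 - 1).

Let mg : measurable_fun setT g. Proof. exact: measurable_density_quotient. Qed.
Let mw : measurable_fun setT w. Proof. exact: adm_mw adm. Qed.
Let w0 x : 0 < w x. Proof. exact: adm_w0 adm _. Qed.

Let mabs (z : R) : measurable_fun setT (fun x => `|g x| `^ z).
Proof. apply: (measurableT_comp (measurable_powR z)); exact: measurableT_comp. Qed.

Let mF : measurable_fun setT F. Proof. exact: measurable_funM. Qed.
Let F0 x : 0 <= F x. Proof. by rewrite mulr_ge0 ?powR_ge0// ltW. Qed.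

Let mE n : measurable (E n).
Proof.
have mq : measurable_fun setT (fun x => `|g x| `^ (p - 1) * w x / phi x).
  by apply: measurable_funM => //; exact: measurable_funM.
rewrite (_ : E n = setT `&` (fun x => `|g x| `^ (p - 1) * w x / phi x) @^-1`
  `]-oo, n%:R]).
  by apply: mq => //; exact: measurable_itv.
by rewrite setTI; apply/seteqP; split=> x; rewrite /E /= in_itv.
Qed.

Let p10 : 0 < p - 1. Proof. by rewrite subr_gt0. Qed.

Let norm_sgpow x : `|sgpow x| = `|g x| `^ (p - 1).
Proof. by rewrite /sgpow normrM (ger0_norm (powR_ge0 _ _)) mulr_powRB1. Qed.

Let sgpow_mul x : sgpow x * g x = `|g x| `^ p.
Proof.
rewrite -(mulr_powRB1 (normr_ge0 _) p0) -(mulr_powRB1 (normr_ge0 _) p10).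
by rewrite /sgpow mulrAC -expr2 -real_normK ?num_real// expr2 mulrA.
Qed.

Let indic01 (A : set X) x : 0 <= (\1_A x : R) <= 1.
Proof. by rewrite indicE; case: (x \in A); rewrite ?lexx ?ler01. Qed.

(** On [E n], [F = |g| * (|g|^(p - 1) w) <= |g| n phi = n |h|]. Integrability of [h] thus makes the
    truncated integrals [G n i] finite before anything is known about the norm of [g]. *)
Let EF_le n x : \1_(E n) x * F x <= n%:R * `|h x|.
Proof.
rewrite indicE; have [/set_mem|_] := boolP (x \in E n); last first.
  by rewrite mul0r mulr_ge0.
rewrite /E /= ler_pdivrMr// mul1r => gn.
rewrite /F -mulr_powRB1// -mulrA.
apply: (le_trans (ler_wpM2l (normr_ge0 _) gn)).
rewrite /density_quotient normrM normfV (gtr0_norm (phi0 x)).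
by rewrite le_eqVlt; apply/orP; left; apply/eqP; field; rewrite gt_eqF.
Qed.

Let EF0 n x : 0 <= \1_(E n) x * F x.
Proof. by rewrite mulr_ge0//; have /andP[] := indic01 (E n) x. Qed.

Let G0 n i : (0 <= G n i)%E.
Proof.
by apply: integral_ge0 => x _; rewrite lee_fin.
Qed.

Let mEF n : measurable_fun setT (fun x => \1_(E n) x * F x).
Proof. by apply: measurable_funM => //; exact: measurable_indic. Qed.

Let Gfin n i : G n i \is a fin_num.
Proof.
rewrite ge0_fin_numE//.
have inh : mu.-integrable setT (fun x => (n%:R)%:E * (EFin \o h) x)%E.
  exact: integrableZl.
have /integrableP[_] : mu.-integrable (cube i) (fun x => (\1_(E n) x * F x)%:E).
  apply: (@le_integrable _ _ _ _ _ _ _ (fun x => n%:R%:E * (EFin \o h) x)%E).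
  - exact: adm_mQ adm i.
  - by apply/measurable_EFinP; exact: measurable_funTS.
  - move=> x _; rewrite /= lee_fin (ger0_norm (EF0 n x)).
    by rewrite normrM normr_nat EF_le.
  - by apply: integrableS inh => //; exact: adm_mQ adm i.
apply: le_lt_trans; apply: ge0_le_integral => //.
- exact: adm_mQ adm i.
- by move=> x _; rewrite lee_fin.
- by apply/measurable_EFinP; exact: measurable_funTS.
- by apply/measurableT_comp/measurable_EFinP => //; exact: measurable_funTS.
- by move=> x _; exact: lee_abs.
Qed.

(* Normalizes b n i into a block; as 0^-1 = 0, the block is 0 if G n i = 0. *)
Let c n i := W i / fine (G n i) `^ q^-1.
Let b n i x := c n i * (sgpow x * w x * (\1_(E n) x * \1_(cube i) x)).

Let c0 n i : 0 <= c n i.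
Proof. by rewrite divr_ge0 ?powR_ge0// ltW. Qed.

(** The left side is the integral of [b n i * g]; by [1 - 1/q = 1/p] it is the term of index [i] in
    the norm of [g] truncated to [E n]. *)
Let cG n i : c n i * fine (G n i) = W i * fine (G n i) `^ p^-1.
Proof.
rewrite /c; set y := fine (G n i); have : 0 <= y by exact: fine_ge0.
rewrite le_eqVlt => /predU1P[<-|y0].
  by rewrite mulr0 powR0 ?mulr0// invr_neq0// gt_eqF.
rewrite -mulrA; congr (_ * _).
have -> : p^-1 = 1 - q^-1 by rewrite -pq addrK.
by rewrite powRB ?(gt_eqF y0) ?implybT// (powRr1 (ltW y0)) mulrC.
Qed.

(** From [(p - 1) q = p] and [q - 1/(p - 1) = 1]. The size of the block and its pairing with [g] are
    thus governed by integrals of the same function [F]. *)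
Let density_sgpow x : (`|sgpow x| * w x) `^ q * v x = F x.
Proof.
have hpq := conj_expE p1 q1 pq.
rewrite norm_sgpow powRM ?powR_ge0 ?(ltW (w0 x))// -powRrM.
have -> : (p - 1) * q = p by move: hpq; rewrite mulrBr; lra.
rewrite -mulrA /F /dual_weight -powRD ?(gt_eqF (w0 x)) ?implybT//.
have -> : q - (p - 1)^-1 = 1.
  apply: (mulfI (lt0r_neq0 p10)); rewrite mulrBr mulfV ?gt_eqF//.
  by move: hpq; rewrite mulrBr; lra.
by rewrite powRr1 ?(ltW (w0 x)).
Qed.

Let msgw : measurable_fun setT (fun x => sgpow x * w x).
Proof.
by apply: measurable_funM => //; apply: measurable_funM => //; exact: mabs.
Qed.

Let mb n i : measurable_fun setT (b n i).
Proof.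
apply: measurable_funM => //; apply: measurable_funM => //.
apply: measurable_funM; apply: measurable_indic => //.
exact: adm_mQ adm i.
Qed.

Let block_b n i : is_block mu w p t (cube i) (b n i).
Proof.
apply/(is_blockP t adm) => //.
  by move=> x xi; rewrite /b [\1_(cube i) x]indicE memNset// !mulr0.
rewrite (eq_integral (fun x => (c n i `^ q)%:E * (\1_(E n) x * F x)%:E)%E).
  rewrite ge0_integralZl_EFin ?powR_ge0//; last 3 first.
  - exact: adm_mQ adm i.
  - by move=> x _; rewrite lee_fin.
  - by apply/measurable_EFinP; exact: measurable_funTS.
  rewrite -/(G n i) -(fineK (Gfin n i)) -EFinM lee_fin /c.
  set y := fine (G n i); have : 0 <= y by exact: fine_ge0.
  rewrite le_eqVlt => /predU1P[<-|y0]; first by rewrite mulr0 powR_ge0.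
  rewrite powR_div ?(ltW (W0 i)) ?powR_gt0// -powRrM mulVf ?gt_eqF//.
  by rewrite powRr1 ?(ltW y0)// divfK ?gt_eqF.
move=> x xi; rewrite /b [\1_(cube i) x]indicE xi mulr1 -EFinM; congr EFin.
rewrite -density_sgpow normrM powRM// (ger0_norm (c0 n i)) -mulrA.
congr (_ * _); rewrite normrM powRM// normrM (gtr0_norm (w0 x)) mulrC mulrA.
rewrite [LHS]mulrC; congr (_ * _); last by rewrite mulrC.
rewrite indicE; case: (x \in E n); first by rewrite normr1 powR1.
by rewrite normr0 powR0 ?gt_eqF.
Qed.

(** For [f := sum lam i * b n i], the left side is [J f], computed by [cG], and the sum on the right
    is at least the norm of [f]. *)
Let test_function n (Fs : {fset index}) (lam : index -> R) :
  (forall i, 0 <= lam i) ->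
  \sum_(i <- Fs) lam i * (W i * fine (G n i) `^ p^-1) <=
    K * (\sum_(i <- Fs) lam i `^ r') `^ r'^-1.
Proof.
move=> lam0.
pose f x := \sum_(i <- Fs) lam i * b n i x.
pose lam' i := if i \in Fs then lam i else 0.
have mf : measurable_fun setT f.
  by apply: measurable_sum => i; apply: measurable_funM.
have dec : decomp f lam' (b n).
  split=> //; apply: aeW => x /=.
  have [|su sE] := @signed_esum_fset _ _ Fs (fun i => lam' i * b n i x).
    by move=> i /negbTE iF; rewrite /lam' iF mul0r.
  split=> //; rewrite -sE; congr EFin; apply: eq_big_seq => i iF.
  by rewrite /lam' iF.
pose S := \sum_(i <- Fs) lam i `^ r'.
have S0 : 0 <= S by apply: sumr_ge0 => i _; exact: powR_ge0.
have Nf : (coef_norm r lam' <= (S `^ r'^-1)%:E)%E.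
  rewrite (coef_norm_le adm) ?powR_ge0// -powRrM mulVf ?gt_eqF// powRr1//.
  rewrite (@esum_fset_support _ _ Fs); last 2 first.
  - by move=> i /negbTE iF; rewrite /lam' iF normr0 powR0// gt_eqF.
  - by move=> i; exact: powR_ge0.
  rewrite lee_fin le_eqVlt; apply/orP; left; apply/eqP.
  by apply: eq_big_seq => i iF; rewrite /lam' iF ger0_norm.
have Hf : H f.
  by split=> //; exists lam', (b n); split=> //; exact: le_lt_trans Nf (ltry _).
have := functional_le_ge0 Hf (powR_ge0 _ _) (le_trans (block_norm_le r dec) Nf).
apply: le_trans.
pose s x := f x / phi x.
have ms : measurable_fun setT s by exact: measurable_funM.
(* By definition of [E n], [|b n i| <= c n i * n * phi]. So [f / phi] is bounded and the integral
   formula for bounded multiples of [phi] applies; the final 1 makes [M] positive. *)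
pose M := \sum_(i <- Fs) lam i * (c n i * n%:R) + 1.
have M0 : 0 < M.
  rewrite ltr_wpDl//; apply: sumr_ge0 => i _.
  by apply: mulr_ge0 => //; apply: mulr_ge0.
have sM x : `|s x| <= M.
  rewrite /s normrM normfV (gtr0_norm (phi0 x)) ler_pdivrMr//.
  apply: (@le_trans _ _ (\sum_(i <- Fs) lam i * (c n i * n%:R) * phi x)).
    apply: (le_trans (ler_norm_sum _ _ _)); apply: ler_sum => i _.
    rewrite normrM (ger0_norm (lam0 i)) -[leRHS]mulrA -(mulrA (c n i)).
    rewrite ler_wpM2l// /b normrM.
    rewrite (ger0_norm (c0 n i)) ler_wpM2l// normrM (normrM (sgpow x)) norm_sgpow.
    rewrite (normrM (\1_(E n) x)) (gtr0_norm (w0 x)).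
    have /andP[/ger0_norm-> _] := indic01 (E n) x.
    have /andP[i0 i1] := indic01 (cube i) x; rewrite (ger0_norm i0).
    rewrite indicE; have [/set_mem|_] := boolP (x \in E n); last first.
      by rewrite mul0r mulr0 mulr_ge0// ltW.
    rewrite /E /= ler_pdivrMr// mul1r => gn; apply: le_trans gn.
    by rewrite ler_piMr// mulr_ge0 ?powR_ge0// ltW.
  rewrite -mulr_suml ler_wpM2r ?(ltW (phi0 x))// /M lerDl//.
have := functional_mul_density ms M0 sM.
have -> : (fun x => s x * phi x) = f.
  by apply/funext => x; rewrite /s divfK// gt_eqF.
move=> ->; apply: le_trans (ler_norm _).
rewrite /Rintegral (eq_integral (fun x => \sum_(i <- Fs)
   ((lam i * c n i)%:E * (\1_(E n) x * F x * \1_(cube i) x)%:E))%E); last first.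
  move=> x _; rewrite (eq_bigr (fun i =>
    (lam i * c n i * (\1_(E n) x * F x * \1_(cube i) x))%:E)); last first.
    by move=> i _; rewrite -EFinM.
  rewrite sumEFin; congr EFin; rewrite /s /f mulr_suml mulr_suml.
  apply: eq_bigr => i _; rewrite /b /F -sgpow_mul /density_quotient; ring.
have pos (i : index) x : (0 <= (\1_(E n) x * F x * \1_(cube i) x)%:E)%E.
  have /andP[? _] := indic01 (E n) x; have /andP[? _] := indic01 (cube i) x.
  by rewrite lee_fin mulr_ge0// mulr_ge0.
have mEFi (i : index) :
    measurable_fun setT (fun x => (\1_(E n) x * F x * \1_(cube i) x)%:E).
  apply/measurable_EFinP; apply: measurable_funM => //.
  by apply: measurable_indic; exact: adm_mQ adm i.
rewrite ge0_integral_sum//; last 2 first.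
- by move=> i; apply: emeasurable_funM => //; exact: measurable_cst.
- by move=> i x _; rewrite mule_ge0// lee_fin mulr_ge0.
rewrite (eq_bigr (fun i => (lam i * (W i * fine (G n i) `^ p^-1))%:E)).
  by rewrite sumEFin.
move=> i _; rewrite ge0_integralZl_EFin ?(mulr_ge0 (lam0 i) (c0 n i))//.
transitivity ((lam i * c n i)%:E * (fine (G n i))%:E)%E; last first.
  by rewrite -EFinM -mulrA cG.
rewrite fineK//; congr (_ * _)%E.
rewrite /G [in RHS]integral_mkcond; apply: eq_integral => x _.
by rewrite epatch_indic /= EFinM.
Qed.

(** The sets [E n] increase to [X], so monotone convergence on each cube removes the truncation from
    [test_function] for finite sums, and [lr_norm_converse] concludes. *)
Lemma density_quotient_norm : (BMN g <= K%:E)%E.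
Proof.
pose Ginf (i : index) := (\int[mu]_(x in cube i) (F x)%:E)%E.
have Ecv x : \forall n \near \oo, E n x.
  pose y := `|g x| `^ (p - 1) * w x / phi x.
  exists (Num.trunc y).+1 => // n /= yn; rewrite /E /= -/y.
  apply: ltW; apply: (lt_le_trans (truncnS_gt y)).
  by rewrite ler_nat.
have Gcv i : G n i @[n --> \oo] --> Ginf i.
  have := @cvg_monotone_convergence _ _ _ mu _ (adm_mQ adm i)
    (fun n x => (\1_(E n) x * F x)%:E).
  rewrite (eq_integral (fun x => (F x)%:E)); last first.
    move=> x _; apply/cvg_lim => //; apply: cvg_near_cst.
    by apply: filterS (Ecv x) => n xE; rewrite indicE mem_set// mul1r.
  apply.
  - by move=> n; apply/measurable_EFinP; exact: measurable_funTS.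
  - by move=> n x _; rewrite lee_fin.
  - move=> x _ m n mn; rewrite lee_fin ler_wpM2r// !indicE.
    have [/set_mem xm|_] := boolP (x \in E m); last by case: (_ \in E n).
    rewrite mem_set// /E /=; apply: (le_trans xm).
    by rewrite ler_nat.
have Ginf0 i : (0 <= Ginf i)%E.
  by apply: integral_ge0 => x _; rewrite lee_fin.
(* A single index with coefficient 1 gives [W i * G^(1/p) <= K] uniformly in [n], which bounds the
   limit. *)
have Gfin' i : Ginf i \is a fin_num.
  rewrite ge0_fin_numE//; apply: (@le_lt_trans _ _ ((K / W i) `^ p)%:E).
    apply: (cvge_to_le (Gcv i)); apply: nearW => n.
    have := test_function n [fset i]%fset (fun=> ler01).
    rewrite !big_seq_fset1 mul1r !powR1 mulr1 mulrC -ler_pdivlMr//.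
    move=> /(ge0_ler_powR (ltW p0)); rewrite !nnegrE powR_ge0.
    rewrite divr_ge0 ?(ltW (W0 i))// => /(_ isT isT).
    by rewrite -powRrM mulVf ?gt_eqF// powRr1 ?fine_ge0// -lee_fin fineK.
  exact: ltry.
have Gcv' i : fine (G n i) @[n --> \oo] --> fine (Ginf i).
  by apply/fine_cvg; rewrite fineK.
rewrite (BM_normE t adm); apply: (lr_norm_converse (proj2 (conj_expr adm))) => //.
  by move=> i; rewrite mule_ge0 ?poweR_ge0// lee_fin ltW.
move=> Fs lam lam0.
rewrite (eq_bigr (fun i => (lam i * (W i * fine (Ginf i) `^ p^-1))%:E)); last first.
  move=> i _; rewrite -/(Ginf i) -(fineK (Gfin' i)) poweR_EFin -!EFinM.
  by rewrite fineK.
rewrite sumEFin lee_fin.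
have cv : \sum_(i <- Fs) lam i * (W i * fine (G n i) `^ p^-1) @[n --> \oo] -->
    \sum_(i <- Fs) lam i * (W i * fine (Ginf i) `^ p^-1).
  apply: (@cvg_sum_seq _ _ _ (fun n i => lam i * (W i * fine (G n i) `^ p^-1))).
  move=> i; apply: cvgMl_tmp; apply: cvgMl_tmp.
  apply: powR_cvg => [|n|]; [by rewrite invr_gt0|exact: fine_ge0|].
  exact: Gcv'.
by apply: (cvgr_to_le cv); apply: nearW => n; exact: test_function.
Qed.

(** [f] is cut where [|f| > n phi]. Off this set it is a bounded multiple of [phi] and the formula
    is known; on it, order continuity makes both [J] and the pairing small. *)
Lemma functional_pairing f : H f -> J f = pairing mu g f.
Proof.
move=> Hf; have mf : measurable_fun setT f by case: Hf.
have K1 : 0 < K + 1 by rewrite ltr_wpDl.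
have gK : (BMN g <= (K + 1)%:E)%E.
  by apply: (le_trans density_quotient_norm); rewrite lee_fin lerDl.
pose D n := [set x | n%:R < `|f x| / phi x].
have mD n : measurable (D n).
  have mq : measurable_fun setT (fun x => `|f x| / phi x).
    by apply: measurable_funM => //; exact: measurableT_comp.
  rewrite (_ : D n = setT `&` (fun x => `|f x| / phi x) @^-1` `]n%:R, +oo[).
    by apply: mq => //; exact: measurable_itv.
  by rewrite setTI; apply/seteqP; split=> x; rewrite /D /= in_itv/= andbT.
have Dcv x : \forall n \near \oo, ~ D n x.
  exists (Num.trunc (`|f x| / phi x)).+1 => // n /= yn; rewrite /D /=.
  apply/negP; rewrite -leNgt; apply: ltW; apply: (lt_le_trans (truncnS_gt _)).
  by rewrite ler_nat.
have split_f n : f = fun x => \1_(D n) x * f x + \1_(~` D n) x * f x.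
  apply/funext => x; rewrite -mulrDl !indicE in_setC.
  by case: (x \in D n); rewrite ?addr0 ?add0r mul1r.
have HD n : H (fun x => \1_(D n) x * f x) by exact: (block_space_indic adm).
have HC n : H (fun x => \1_(~` D n) x * f x).
  by apply: (block_space_indic adm) => //; exact: measurableC.
have JC n : J (fun x => \1_(~` D n) x * f x) =
    pairing mu g (fun x => \1_(~` D n) x * f x).
  pose s x := \1_(~` D n) x * f x / phi x.
  have ms : measurable_fun setT s.
    apply: measurable_funM => //; apply: measurable_funM => //.
    by apply: measurable_indic; exact: measurableC.
  have := @functional_mul_density s (n%:R + 1) ms.
  rewrite ltr_wpDl// => /(_ isT) sE.
  transitivity (\int[mu]_x (s x * h x)).
    rewrite -sE.
      by congr J; apply/funext => x; rewrite /s divfK// gt_eqF.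
    move=> x; rewrite /s indicE in_setC.
    have [_|/negP] := boolP (x \in D n).
      by rewrite !mul0r normr0 addr_ge0.
    rewrite inE /D /= => /negP; rewrite -leNgt => fx.
    rewrite mul1r normrM normfV (gtr0_norm (phi0 x)) (le_trans fx)// lerDl//.
  apply: eq_Rintegral => x _; rewrite /s /density_quotient; ring.
apply/eqP; rewrite -subr_eq0 -normr_le0; apply/ler_addgt0Pl => e e0.
(* Each of the two errors is to be at most [e / 2], with constants [K] and [K + 1]; the last halving
   gives the strict bound on the norm that [pairing_le_norm] asks for. *)
have e1 : 0 < e / 2 / (K + 1) / 2 by rewrite !divr_gt0.
have [n _ /(_ n (leqnn n)) Nn] := block_norm_vanish adm Hf mD Dcv e1.
have -> : J f = J (fun x => \1_(D n) x * f x) + J (fun x => \1_(~` D n) x * f x).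
  by rewrite -(functionalD dualJ)// -split_f.
have -> : pairing mu g f = pairing mu g (fun x => \1_(D n) x * f x) +
    pairing mu g (fun x => \1_(~` D n) x * f x).
  rewrite /pairing -RintegralD//.
  - apply: eq_Rintegral => x _; rewrite -mulrDl; congr (_ * _).
    exact: (congr1 (fun k => k x) (split_f n)).
  - by apply: (pairing_integrable adm) => //; exact: le_lt_trans gK (ltry _).
  - by apply: (pairing_integrable adm) => //; exact: le_lt_trans gK (ltry _).
rewrite JC opprD addrACA subrr !addr0; apply: (le_trans (ler_normB _ _)).
have e2 : 0 < e / 2 / (K + 1) by rewrite !divr_gt0.
rewrite [leRHS](splitr e); apply: lerD.
  apply: (le_trans (functional_le adm dualJ (HD n) e1 Nn)).
  rewrite mulrA ler_pdivrMr// mulrA ler_pdivrMr//; nra.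
apply: (le_trans (pairing_le_norm adm (C := e / 2 / (K + 1)) (HD n) mg K1 gK _)).
  by apply: (le_lt_trans Nn); rewrite lte_fin ltr_pdivrMr// ltr_pMr// ltr1n.
by rewrite divfK// gt_eqF.
Qed.

End representation.

(** * The functional given by the pairing: bounds and uniqueness *)

Section pairing_functional.
Context {R : realType} {d : measure_display} {X : measurableType d}.
Variables (mu : {measure set X -> \bar R}) (I : int -> choiceType).
Variables (Q : forall k : int, I k -> set X) (w : X -> R) (p t : R).
Variables (r : \bar R).
Hypothesis adm : admissible mu Q w p r.
Local Notation BMN := (BM_norm mu Q w p t r).
Local Notation H := (block_space mu Q w p t r).
Local Notation N := (block_norm mu Q w p t r).

(** For [r = +oo] the norm is a supremum, equal to [-oo] over an empty index set; hence the index
    [i0]. *)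
Lemma BM_norm_ge0 (i0 : {k : int & I k}) g : (0 <= BMN g)%E.
Proof.
rewrite (BM_normE t adm); case: (adm_r adm) => [[s -> _]|->].
  exact: poweR_ge0.
by apply: le_trans (ereal_sup_ubound _); last by exists i0.
Qed.

Lemma pairing_linear g : measurable_fun setT g -> (BMN g < +oo)%E ->
  linear_on H (pairing mu g).
Proof.
move=> mg gfin a f k Hf Hk.
have if_ := pairing_integrable adm Hf mg gfin.
have ik := pairing_integrable adm Hk mg gfin.
rewrite /pairing -RintegralZl// -RintegralD//.
  by apply: eq_Rintegral => x _; rewrite mulrDl mulrA.
by have := integrableZl measurableT a if_; exact.
Qed.

Lemma pairing_bounded g : measurable_fun setT g -> (BMN g < +oo)%E ->
  bounded_on H N (pairing mu g).
Proof.
move=> mg gfin.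
have [B B0 gB] := ereal_ubound_gt0 gfin.
exists B => f Hf.
have Nfin : N f \is a fin_num.
  by rewrite ge0_fin_numE ?(block_norm_ge0 t adm) ?block_norm_fin.
rewrite -(fineK Nfin) -EFinM lee_fin; apply/ler_addgt0Pl => e e0.
have eB : 0 < e / B by rewrite divr_gt0.
apply: (le_trans (pairing_le_norm adm (C := fine (N f) + e / B) Hf mg B0 gB _)).
  by rewrite -[ltLHS](fineK Nfin) lte_fin ltrDl.
by rewrite mulrDl divfK ?gt_eqF// addrC mulrC.
Qed.

Lemma pairing_le_BM_norm (i0 : {k : int & I k}) g f : measurable_fun setT g ->
  (BMN g < +oo)%E -> H f -> (N f <= 1)%E -> (`|pairing mu g f|%:E <= BMN g)%E.
Proof.
move=> mg gfin Hf Nf.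
have bfin : BMN g \is a fin_num by rewrite ge0_fin_numE// (BM_norm_ge0 i0).
rewrite -(fineK bfin) lee_fin; set b := fine (BMN g).
have b0 : 0 <= b by rewrite fine_ge0// (BM_norm_ge0 i0).
apply/ler_addgt0Pl => e e0.
have b20 : 0 < b + 2 by rewrite ltr_wpDl.
(* Both bounds, [b] and 1, are relaxed by [e']: since [e' <= 1], [(1 + e')(b + e') <= b + e'(b + 2)
   <= b + e]. *)
pose e' := Num.min 1 (e / (b + 2)).
have e'0 : 0 < e' by rewrite lt_min ltr01 divr_gt0.
have be0 : 0 < b + e' by rewrite ltr_wpDl.
have gb : (BMN g <= (b + e')%:E)%E.
  by rewrite -(fineK bfin) lee_fin lerDl ltW.
have Nlt : (N f < (1 + e')%:E)%E.
  by apply: (le_lt_trans Nf); rewrite lte_fin ltrDl.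
apply: (le_trans (pairing_le_norm adm Hf mg be0 gb Nlt)).
have e'1 : e' <= 1 by rewrite ge_min lexx.
have e'e : e' * (b + 2) <= e by rewrite -ler_pdivlMr// ge_min lexx orbT.
nra.
Qed.

(** Tested on [1_A phi] with [A] the set where [g < h]: the nonnegative function [1_A phi (h - g)]
    has integral 0, so [A] is null. Exchanging [g] and [h] gives uniqueness. *)
Lemma pairing_inj_le phi g h : H phi -> (forall x, 0 < phi x) ->
  measurable_fun setT g -> (BMN g < +oo)%E ->
  measurable_fun setT h -> (BMN h < +oo)%E ->
  (forall f, H f -> pairing mu g f = pairing mu h f) ->
  {ae mu, forall x, h x <= g x}.
Proof.
move=> Hphi phi0 mg gfin mh hfin gh.
pose A := [set x | g x < h x].
have mA : measurable A.
  have mq : measurable_fun setT (fun x => h x - g x).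
    exact: measurable_funB.
  rewrite (_ : A = setT `&` (fun x => h x - g x) @^-1` `]0, +oo[).
    by apply: mq => //; exact: measurable_itv.
  by rewrite setTI; apply/seteqP; split=> x; rewrite /A /= in_itv/= andbT subr_gt0.
have HA := block_space_indic adm Hphi mA.
have ig := pairing_integrable adm HA mg gfin.
have ih := pairing_integrable adm HA mh hfin.
pose k x := \1_A x * phi x * h x - \1_A x * phi x * g x.
have k0 x : 0 <= k x.
  rewrite /k -mulrBr indicE; have [/set_mem xA|_] := boolP (x \in A).
    by rewrite mul1r mulr_ge0 ?(ltW (phi0 x))// subr_ge0 ltW.
  by rewrite !mul0r.
have ik : mu.-integrable setT (EFin \o k).
  by have := integrableB measurableT ih ig; exact.
have Ik : \int[mu]_x k x = 0.
  rewrite RintegralB//; apply/eqP; rewrite subr_eq0; apply/eqP.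
  exact/esym/gh.
have Ek : (\int[mu]_x `|(k x)%:E| = 0)%E.
  under eq_integral do rewrite abse_EFin ger0_norm//.
  rewrite -[LHS]fineK; first by rewrite -/(Rintegral _ _ _) Ik.
  by apply: integral_fune_fin_num.
have := (ae_eq_integral_abs mu measurableT (measurable_int _ ik)).1 Ek.
apply: filterS => x /(_ Logic.I) /= [kx].
have [//|gx] := leP (h x) (g x).
have : 0 < k x.
  by rewrite /k -mulrBr indicE mem_set// mul1r mulr_gt0// subr_gt0.
by rewrite kx ltxx.
Qed.

End pairing_functional.

(** The duality with the geometry reduced to hypotheses on the cubes; [rho] enters through [Lp_loc],
    and the index in the hypotheses serves [BM_norm_ge0]. *)
Lemma block_BM_duality {R : realType} {d : measure_display}
    {X : measurableType d} (rho : X -> X -> R)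
    (mu : {sigma_finite_measure set X -> \bar R}) (I : int -> choiceType)
    (Q : forall k : int, I k -> set X) (w : X -> R) (p t : R) (r : \bar R) :
  admissible mu Q w p r ->
  (forall a b : I 0, Q 0 a `&` Q 0 b !=set0 -> a = b) ->
  {ae mu, forall x, exists a, Q 0 a x} ->
  {k : int & I k} ->
  (forall g, measurable_fun setT g -> (BM_norm mu Q w p t r g < +oo)%E ->
     Lp_loc rho mu w p g) ->
  let M := BM_space rho mu Q w p t r in
  let normM := BM_norm mu Q w p t r in
  let H := block_space mu Q w p t r in
  let normH := block_norm mu Q w p t r in
  (forall g, M g ->
     [/\ forall f, H f -> mu.-integrable setT (fun x => (f x * g x)%:E),
         linear_on H (pairing mu g) &
         bounded_on H normH (pairing mu g)])
  /\
  (forall J, in_dual H normH J ->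
     exists g, [/\ M g,
       forall f, H f -> J f = pairing mu g f,
       forall h, M h -> (forall f, H f -> J f = pairing mu h f) ->
         {ae mu, forall x, h x = g x} &
       normM g = dual_norm H normH J]).
Proof.
move=> adm disj cover i0 loc M normM H normH; split.
  move=> g [[mg _] gfin]; split.
  - by move=> f Hf; exact: (pairing_integrable adm Hf mg gfin).
  - exact: (pairing_linear adm mg gfin).
  - exact: (pairing_bounded adm mg gfin).
move=> J dualJ.
have [phi Hphi phi0] := block_space_gt0 t adm disj cover.
have [h ih Jh] := functional_density adm Hphi dualJ.
pose g := density_quotient phi h.
have mg : measurable_fun setT g.
  exact: (measurable_density_quotient Hphi phi0 ih).
have gK := density_quotient_norm adm Hphi phi0 dualJ ih Jh.
have gfin : (normM g < +oo)%E by exact: le_lt_trans gK (ltry _).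
have Jg f : H f -> J f = pairing mu g f.
  exact: (functional_pairing adm Hphi phi0 dualJ ih Jh).
exists g; split=> //.
- by split=> //; exact: loc.
- move=> k [[mk _] kfin] Jk.
  have gk f : H f -> pairing mu g f = pairing mu k f.
    by move=> Hf; rewrite -Jg// Jk.
  have kg f : H f -> pairing mu k f = pairing mu g f by move=> /gk.
  have le1 := pairing_inj_le adm Hphi phi0 mg gfin mk kfin gk.
  have le2 := pairing_inj_le adm Hphi phi0 mk kfin mg gfin kg.
  by apply: filterS2 le1 le2 => x le1 le2; apply/eqP; rewrite eq_le le1 le2.
- apply/eqP; rewrite eq_le -{1}(fineK (dual_norm_fin adm dualJ)) gK /=.
  apply: ge_ereal_sup => _ [f [Hf Nf] <-]; rewrite Jg//.
  exact: (pairing_le_BM_norm adm i0).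
Qed.

(** * Dyadic cubes *)

Section sigma_finite_measure_of.
Context {d : measure_display} {X : measurableType d} {R : realType}.
Variables (mu : {measure set X -> \bar R}) (sf : sigma_finite setT mu).

(** The anonymous argument makes the proof of sigma-finiteness part of the term, so that the
    instance below can find it. *)
Definition sigma_finite_copy of sigma_finite setT mu : set X -> \bar R := mu.

HB.instance Definition _ := Measure.copy (sigma_finite_copy sf) mu.
HB.instance Definition _ :=
  Measure_isSigmaFinite.Build _ _ _ (sigma_finite_copy sf) sf.

Lemma sigma_finite_measure_of :
  exists nu : {sigma_finite_measure set X -> \bar R},
    (nu : {measure set X -> \bar R}) = mu.
Proof. by exists (sigma_finite_copy sf); apply: eq_measure. Qed.

End sigma_finite_measure_of.

Section cubes.
Context {R : realType} {d : measure_display} {X : measurableType d}.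
Variables (rho : X -> X -> R) (mu : {measure set X -> \bar R}) (n : R).
Hypothesis hX : homogeneous_space rho mu n.
Variables (I : int -> choiceType) (Q : forall k : int, I k -> set X).
Hypothesis hQ : dyadic_system rho mu Q.

Let pow_gt0 (k : int) : 0 < (2^-1 : R) ^ k.
Proof. by rewrite exprz_gt0// invr_gt0. Qed.

Lemma qopen_measurable (U : set X) : qopen rho U -> measurable U.
Proof. by move=> oU; rewrite (hs_borel hX); exact: sub_sigma_algebra. Qed.

Lemma measurable_cube k tau : measurable (@Q k tau).
Proof. exact/qopen_measurable/(ds_open hQ). Qed.

Let rho_xx x : rho x x = 0.
Proof. exact/(qd_eq0 (hs_quasi_distance hX)). Qed.

Lemma cube_center k tau : exists2 x, @Q k tau x &
  qball rho x (2^-1 * 2^-1 ^ k) `<=` @Q k tau.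
Proof.
have [x xQ] := ds_inner_ball hQ tau.
by exists x => //; apply: xQ; rewrite /qball /= rho_xx mulr_gt0// invr_gt0.
Qed.

Lemma cube_bounded k : exists2 s : R, 0 < s &
  forall tau x, @Q k tau x -> @Q k tau `<=` qball rho x s.
Proof.
have [kappa0 k0 diamQ] := ds_diam hQ.
exists (kappa0 * 2^-1 ^ k + 1); first by rewrite ltr_wpDl// ltW// mulr_gt0.
move=> tau x Qx y Qy; rewrite /qball /=.
by apply: (le_lt_trans (diamQ k tau x y Qx Qy)); rewrite ltrDl.
Qed.

Lemma mu_cube k tau : (0 < mu (@Q k tau) < +oo)%E.
Proof.
have [x Qx xQ] := cube_center tau; have [s s0 /(_ _ _ Qx) Qs] := cube_bounded k.
have r0 : 0 < 2^-1 * 2^-1 ^ k :> R by rewrite mulr_gt0// invr_gt0.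
have /andP[B0 _] := hs_volume hX x r0; have /andP[_ Boo] := hs_volume hX x s0.
apply/andP; split.
  apply: (lt_le_trans B0); apply: le_measure => //; rewrite inE.
    exact: hs_measurable_ball hX _ _.
  exact: measurable_cube.
apply: le_lt_trans Boo; apply: le_measure => //; rewrite inE.
  exact: measurable_cube.
exact: hs_measurable_ball hX _ _.
Qed.

(* Two cubes of one generation that meet are equal as sets; they have the same
   index because a cube of the next generation has a unique parent. *)
Lemma cube_disjoint k (a b : I k) : @Q k a `&` @Q k b !=set0 -> a = b.
Proof.
move=> ab.
have sub (c e : I k) : @Q k c `&` @Q k e !=set0 -> @Q k c `<=` @Q k e.
  move=> ce; have [//|ce0] := ds_nested hQ c e (lexx k).
  by rewrite ce0 in ce; case: ce.
have [tau [y [Qay Qty]]] : exists tau, @Q k a `&` @Q (k + 1) tau !=set0.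
  (* Otherwise [Q k a], of positive measure, would lie in the null set left uncovered by generation
     [k + 1]. *)
  apply: contrapT => no.
  have : (mu (@Q k a) <= mu (~` (\bigcup_(tau in setT) @Q (k + 1) tau)))%E.
    apply: le_measure; rewrite ?inE.
    - exact: measurable_cube.
    - apply/measurableC/qopen_measurable => x [tau _ xQ].
      have [s s0 sQ] := ds_open hQ xQ.
      by exists s => // z /sQ zQ; exists tau.
    - by move=> x Qax [tau _ Qtx]; apply: no; exists tau, x.
  rewrite (ds_cover hQ); have /andP[+ _] := mu_cube a.
  by move=> /lt_le_trans h /h; rewrite ltxx.
have k1 : k < k + 1 by rewrite ltrDl.
have ta : @Q (k + 1) tau `<=` @Q k a.
  have [//|ta0] := ds_nested hQ tau a (ltW k1).
  by have : (@Q (k + 1) tau `&` @Q k a) y by []; rewrite ta0.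
have [c [_ cuniq]] := ds_ancestor hQ tau k1.
rewrite -(cuniq _ ta) -(cuniq b)//.
by apply: subset_trans ta _; exact: sub.
Qed.

(** A volume count: the cubes in question are disjoint, lie in one ball of volume [V], and each has
    measure at least [V / Cl] by the dimension bound applied to its inner ball. There are at most
    [Cl] of them. *)
Lemma finite_cubes_meeting_ball k x0 s :
  finite_set [set tau : I k | @Q k tau `&` qball rho x0 s !=set0].
Proof.
have qd := hs_quasi_distance hX.
have [K0 triK0] := qd_triangle qd.
pose K := Num.max 1 K0.
have K1 : 1 <= K by rewrite le_max lexx.
have Kgt0 : 0 < K by rewrite (lt_le_trans ltr01).
have tri x y z : rho x z <= K * (rho x y + rho y z).
  apply: (le_trans (triK0 x y z)); rewrite ler_wpM2r//.
    by rewrite addr_ge0 ?(qd_ge0 qd).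
  by rewrite le_max lexx orbT.
have [D D0 Dbound] := cube_bounded k.
(* [s] may be nonpositive, and volumes are controlled only for positive radii. A cube meeting the
   ball of radius [s] lies in the ball of radius [S = K (s' + D)], by the quasi-triangle
   inequality. *)
pose s' := Num.max s 1.
have s'0 : 0 < s' by rewrite lt_max ltr01 orbT.
pose S := K * (s' + D).
have S0 : 0 < S by rewrite mulr_gt0// addr_gt0.
pose e : R := 2^-1 * 2^-1 ^ k.
have e0 : 0 < e by rewrite mulr_gt0// invr_gt0.
have [C dimC] := hs_dim hX.
(* The factor by which the inner ball of a cube, of radius [e], has to be enlarged to contain the
   ball of radius [S] about [x0]. *)
pose l := Num.max 1 (K * (S + S) / e).
have l1 : 1 <= l by rewrite le_max lexx.
pose Cl := Num.max 1 (C * l `^ n).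
have Cl0 : 0 < Cl by rewrite lt_max ltr01.
have Sin tau : @Q k tau `&` qball rho x0 s !=set0 -> @Q k tau `<=` qball rho x0 S.
  move=> [y [Qy sy]] z Qz; rewrite /qball /=.
  apply: (le_lt_trans (tri x0 y z)); rewrite ltr_pM2l//; apply: ltrD.
    by apply: (lt_le_trans sy); rewrite le_max lexx.
  exact: Dbound Qy _ Qz.
have /andP[V0 Voo] := hs_volume hX x0 S0.
set V := mu (qball rho x0 S) in V0 Voo.
have Vfin : V \is a fin_num by rewrite ge0_fin_numE// ltW.
have vol tau : @Q k tau `&` qball rho x0 s !=set0 ->
    (V <= Cl%:E * mu (@Q k tau))%E.
  move=> meet; have [x Qx xQ] := cube_center tau.
  have /Sin xS := meet; have x0x := xS _ Qx.
  apply: (@le_trans _ _ (mu (qball rho x (l * e)))).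
    apply: le_measure; rewrite ?inE.
    - exact: hs_measurable_ball hX _ _.
    - exact: hs_measurable_ball hX _ _.
    move=> z zS; rewrite /qball /=; apply: (le_lt_trans (tri x x0 z)).
    apply: (@lt_le_trans _ _ (K * (S + S))).
      by rewrite ltr_pM2l//; apply: ltrD => //; rewrite (qd_sym qd).
    by rewrite -ler_pdivrMr// le_max lexx orbT.
  apply: (le_trans (dimC l x e l1 e0)).
  apply: (@le_trans _ _ (Cl%:E * mu (qball rho x e))%E).
    by apply: lee_wpmul2r => //; rewrite lee_fin le_max lexx orbT.
  apply: lee_wpmul2l; first by rewrite lee_fin ltW.
  apply: le_measure => //; rewrite inE.
    exact: hs_measurable_ball hX _ _.
  exact: measurable_cube.
apply: contrapT => /(@infinite_set_fset _ _ (Num.trunc Cl).+1)[B BA cardB].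
have meetB tau : tau \in B -> @Q k tau `&` qball rho x0 s !=set0.
  by move=> tB; exact: BA.
have sumB : (\sum_(tau <- B) mu (@Q k tau) <= V)%E.
  rewrite -(set_fsetK B) -fsbig_finite//=.
  rewrite -measure_fin_bigcup//; last 2 first.
  - by move=> a b _ _ /cube_disjoint.
  - by move=> tau _; exact: measurable_cube.
  apply: le_measure; rewrite ?inE.
  - by apply: fin_bigcup_measurable => // tau _; exact: measurable_cube.
  - exact: hs_measurable_ball hX _ _.
  - by move=> z [tau /= tB Qz]; exact: (Sin tau (meetB tau tB)).
have : (Cl%:E * V < #|` B|%:R%:E * V)%E.
  rewrite -(fineK Vfin) -!EFinM lte_fin ltr_pM2r; last first.
    by rewrite fine_gt0// V0.
  by apply: (lt_le_trans (truncnS_gt Cl)); rewrite ler_nat.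
apply/negP; rewrite -leNgt.
apply: (@le_trans _ _ (Cl%:E * \sum_(tau <- B) mu (@Q k tau))%E); last first.
  by apply: lee_wpmul2l => //; rewrite lee_fin ltW.
rewrite ge0_sume_distrr//.
apply: (@le_trans _ _ (\sum_(tau <- B) V)%E); last first.
  rewrite big_seq [leRHS]big_seq; apply: lee_sum => tau tB.
  by apply: vol; exact: meetB.
rewrite -(fineK Vfin) sumEFin -EFinM lee_fin big_const_seq iter_addr_0.
by rewrite count_predT mulr_natl.
Qed.

Lemma homogeneous_nonempty : [set: X] !=set0.
Proof.
by apply/set0P/eqP => X0; have := hs_infinite hX; rewrite X0 measure0.
Qed.

Let cover_ball x0 (x : X) : exists m : nat, qball rho x0 m%:R x.
Proof.
exists (Num.trunc (rho x0 x)).+1; rewrite /qball /=; exact: truncnS_gt.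
Qed.

(** Every cube meets a ball of integer radius about a fixed point, and each such ball meets finitely
    many cubes of a given generation. *)
Lemma countable_cubes : countable [set: {k : int & I k}].
Proof.
have Ik k : countable [set: I k].
  have [x0 _] := homogeneous_nonempty.
  rewrite (_ : setT = \bigcup_(m in [set: nat])
      [set tau : I k | @Q k tau `&` qball rho x0 m%:R !=set0]).
    apply: bigcup_countable => // m _.
    exact/finite_set_countable/finite_cubes_meeting_ball.
  apply/seteqP; split=> // tau _.
  have [x Qx _] := cube_center tau; have [m mx] := cover_ball x0 x.
  by exists m => //; exists x.
rewrite (_ : setT = \bigcup_(k in [set: int])
    (existT (fun k => I k) k @` [set: I k])).
  apply: bigcup_countable => // k _.
  exact: sub_countable (card_image_le _ _) (Ik k).
by apply/seteqP; split=> // -[k tau] _; exists k => //; exists tau.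
Qed.

Lemma sigma_finite_homogeneous : sigma_finite setT mu.
Proof.
have [x0 _] := homogeneous_nonempty.
exists (fun m : nat => qball rho x0 m%:R).
  apply/seteqP; split=> // x _; have [m mx] := cover_ball x0 x.
  by exists m.
move=> m; split; first exact: hs_measurable_ball hX _ _.
(* Radius [m + 1], as finiteness of the volume is given for positive radii and [m] may be 0. *)
apply: (@le_lt_trans _ _ (mu (qball rho x0 m.+1%:R))).
  apply: le_measure; rewrite ?inE.
  - exact: hs_measurable_ball hX _ _.
  - exact: hs_measurable_ball hX _ _.
  by move=> x /lt_le_trans; apply; rewrite ler_nat.
by have /andP[] := hs_volume hX x0 (ltr0Sn R m).
Qed.

Lemma cubes_cover k : {ae mu, forall x, exists tau, @Q k tau x}.
Proof.
exists (~` (\bigcup_(tau in setT) @Q k tau)); split.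
- apply/measurableC/qopen_measurable => x [tau _ xQ].
  have [s s0 sQ] := ds_open hQ xQ.
  by exists s => // z /sQ zQ; exists tau.
- exact: ds_cover hQ _.
- by move=> x /= nx [tau _ Qx]; apply: nx; exists tau.
Qed.

End cubes.

(** * Finite Bourgain-Morrey norm implies local integrability *)

Section local_integrability.
Context {R : realType} {d : measure_display} {X : measurableType d}.
Variables (rho : X -> X -> R) (mu : {measure set X -> \bar R}) (n : R).
Hypothesis hX : homogeneous_space rho mu n.
Variables (I : int -> choiceType) (Q : forall k : int, I k -> set X).
Hypothesis hQ : dyadic_system rho mu Q.
Variables (w : X -> R) (p t : R) (r : \bar R).
Hypothesis adm : admissible mu Q w p r.

Lemma BM_norm_integral_fin g (i : {k : int & I k}) :
  (BM_norm mu Q w p t r g < +oo)%E ->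
  (\int[mu]_(x in Q (projT2 i)) (`|g x| `^ p * w x)%:E < +oo)%E.
Proof.
have p0 : 0 < p by rewrite (lt_trans ltr01)// (adm_p adm).
rewrite (BM_normE t adm); set a := fun i => _ => afin.
have a0 j : (0 <= a j)%E.
  by rewrite mule_ge0 ?poweR_ge0// lee_fin ltW// (cube_weight_gt0 t adm).
have ai : (a i < +oo)%E.
  case: (adm_r adm) afin => [[s -> s1]|->] /=; last first.
    apply: le_lt_trans; apply: ereal_sup_ubound; exists i => //.
    by rewrite gee0_abs.
  have s0 : s != 0 by rewrite gt_eqF// (lt_trans ltr01).
  move=> /lty_poweRy; rewrite invr_neq0// => /(_ isT) Sfin.
  apply: (lty_poweRy s0); rewrite -(gee0_abs (a0 i)).
  rewrite -(gee0_abs (poweR_ge0 `|a i|%E s)).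
  apply: (@summable_pinfty _ _ setT (fun i => `|a i| `^ s)%E) => //.
  by rewrite /summable; under eq_esum do rewrite gee0_abs ?poweR_ge0//.
apply: (@lty_poweRy _ _ p^-1); first by rewrite invr_neq0// gt_eqF.
move: ai; rewrite /a.
set S := (\int[mu]_(x in _) _)%E; have : (0 <= S `^ p^-1)%E by exact: poweR_ge0.
case: (S `^ p^-1)%E => [z| |]// _; first by move=> _; exact: ltry.
by rewrite gt0_muley// lte_fin (cube_weight_gt0 t adm).
Qed.

(** A ball is covered, up to a null set, by the finitely many cubes of generation 0 that meet it,
    and on each cube the integral is finite. *)
Lemma BM_norm_Lp_loc g : measurable_fun setT g ->
  (BM_norm mu Q w p t r g < +oo)%E -> Lp_loc rho mu w p g.
Proof.
move=> mg gfin; split=> // x0 s s0.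
pose F x := `|g x| `^ p * w x.
have mF : measurable_fun setT F.
  apply: measurable_funM; last exact: adm_mw adm.
  by apply: (measurableT_comp (measurable_powR p)); exact: measurableT_comp.
have F0 x : 0 <= F x by rewrite mulr_ge0 ?powR_ge0// ltW// (adm_w0 adm).
have /finite_seqP[l lE] := finite_cubes_meeting_ball hX hQ 0 x0 s.
pose f (tau : I 0) x : \bar R := (F x * \1_(Q tau) x)%:E.
have f0 tau x : (0 <= f tau x)%E.
  by rewrite lee_fin mulr_ge0// indicE; case: (x \in Q tau).
have mf tau : measurable_fun setT (f tau).
  apply/measurable_EFinP; apply: measurable_funM => //.
  by apply: measurable_indic; exact: (measurable_cube hX hQ).
apply: (@le_lt_trans _ _ (\sum_(tau <- l) \int[mu]_x f tau x)%E); last first.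
  apply/lte_sum_pinfty => tau _.
  have := @BM_norm_integral_fin g (existT (fun k => I k) 0 tau) gfin.
  rewrite integral_mkcond; apply: le_lt_trans.
  rewrite le_eqVlt; apply/orP; left; apply/eqP; apply: eq_integral => x _.
  by rewrite epatch_indic /= /f EFinM.
rewrite -ge0_integral_sum// integral_mkcond.
apply: ae_ge0_le_integral => //.
- by move=> x _; rewrite /patch; case: ifPn => // _; rewrite lee_fin F0.
- apply/(measurable_restrictT _ _).1; first exact: hs_measurable_ball hX _ _.
  by apply/measurable_EFinP; exact: measurable_funTS.
- by move=> x _; apply: sume_ge0.
- exact: emeasurable_sum.
apply: filterS (cubes_cover hX hQ 0) => x [tau xtau] _.
rewrite /patch; case: ifPn => [/set_mem xB|_]; last exact: sume_ge0.
have tl : tau \in l.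
  have : [set` l] tau by rewrite -lE; exists x.
  by [].
rewrite (big_rem tau)//=; apply: (@le_trans _ _ (f tau x)).
  by rewrite /f indicE mem_set// mulr1.
by rewrite leeDl// sume_ge0.
Qed.

End local_integrability.

(** * Weights *)

(* A weight is only positive almost everywhere; changing it on a null set
   changes neither the spaces nor the norms. *)
Definition positive_version {R : realType} {X : Type} (w : X -> R) : X -> R :=
  fun x => if 0 < w x then w x else 1.

Section positive_weight.
Context {R : realType} {d : measure_display} {X : measurableType d}.
Variables (mu : {measure set X -> \bar R}) (w : X -> R).
Hypotheses (mw : measurable_fun setT w) (w0 : {ae mu, forall x, 0 < w x}).
Local Notation w' := (positive_version w).

Lemma positive_version_gt0 x : 0 < w' x.
Proof. by rewrite /positive_version; case: ifPn. Qed.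

Lemma measurable_positive_version : measurable_fun setT w'.
Proof.
apply: measurable_fun_ifT => //.
by apply: measurable_fun_ltr.
Qed.

Lemma positive_version_ae : {ae mu, forall x, w' x = w x}.
Proof. by apply: filterS w0 => x wx; rewrite /positive_version wx. Qed.

Let integral_ae (A : set X) (f g : X -> R) : measurable A ->
  measurable_fun setT f -> measurable_fun setT g ->
  {ae mu, forall x, f x = g x} ->
  (\int[mu]_(x in A) (f x)%:E = \int[mu]_(x in A) (g x)%:E)%E.
Proof.
move=> mA mf mg fg; apply: ae_eq_integral => //.
- by apply/measurable_EFinP; exact: measurable_funTS.
- by apply/measurable_EFinP; exact: measurable_funTS.
- by apply: filterS fg => x -> _.
Qed.

Lemma wmeas_positive_version A : measurable A ->
  wmeas mu w' A = wmeas mu w A.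
Proof.
move=> mA; apply: integral_ae => //; first exact: measurable_positive_version.
exact: positive_version_ae.
Qed.

Lemma integral_positive_version A p (g : X -> R) : measurable A ->
  measurable_fun setT g ->
  (\int[mu]_(x in A) (`|g x| `^ p * w' x)%:E =
   \int[mu]_(x in A) (`|g x| `^ p * w x)%:E)%E.
Proof.
move=> mA mg.
have mgp : measurable_fun setT (fun x => `|g x| `^ p).
  by apply: (measurableT_comp (measurable_powR p)); exact: measurableT_comp.
apply: integral_ae => //.
- by apply: measurable_funM => //; exact: measurable_positive_version.
- exact: measurable_funM.
- by apply: filterS positive_version_ae => x ->.
Qed.

Lemma integral_dual_positive_version A p q (g : X -> R) : measurable A ->
  measurable_fun setT g ->
  (\int[mu]_(x in A) (`|g x| `^ q * dual_weight p w' x)%:E =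
   \int[mu]_(x in A) (`|g x| `^ q * dual_weight p w x)%:E)%E.
Proof.
move=> mA mg.
have mgp : measurable_fun setT (fun x => `|g x| `^ q).
  by apply: (measurableT_comp (measurable_powR q)); exact: measurableT_comp.
apply: integral_ae => //.
- apply: measurable_funM => //.
  exact: measurable_dual_weight measurable_positive_version.
- by apply: measurable_funM => //; exact: measurable_dual_weight.
- by apply: filterS positive_version_ae => x; rewrite /dual_weight => ->.
Qed.

Lemma integral_dual_weight_positive_version A p : measurable A ->
  (\int[mu]_(x in A) (dual_weight p w' x)%:E =
   \int[mu]_(x in A) (dual_weight p w x)%:E)%E.
Proof.
move=> mA; apply: integral_ae => //.
- exact: measurable_dual_weight measurable_positive_version.
- exact: measurable_dual_weight.
- by apply: filterS positive_version_ae => x; rewrite /dual_weight => ->.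
Qed.

Lemma is_block_positive_version A p t b : measurable A ->
  is_block mu w' p t A b = is_block mu w p t A b.
Proof.
move=> mA; apply/propext; split=> -[mb b0 bA]; split=> //; move: bA.
- by rewrite integral_dual_positive_version// wmeas_positive_version.
- by rewrite integral_dual_positive_version// wmeas_positive_version.
Qed.

Variables (rho : X -> X -> R) (I : int -> choiceType).
Variables (Q : forall k : int, I k -> set X) (p t : R) (r : \bar R).
Hypothesis mQ : forall k tau, measurable (@Q k tau).
Hypothesis mball : forall x s, measurable (qball rho x s).

Lemma block_decomposition_positive_version f lam b :
  block_decomposition mu Q w' p t f lam b =
  block_decomposition mu Q w p t f lam b.
Proof.
rewrite /block_decomposition; congr (_ /\ _).
apply/propext; split=> h i; have := h i.
  by rewrite is_block_positive_version.
by rewrite is_block_positive_version.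
Qed.

Lemma block_space_positive_version :
  block_space mu Q w' p t r = block_space mu Q w p t r.
Proof.
apply/seteqP; split=> f [mf [lam [b [dec fin]]]]; split=> //; exists lam, b;
  split=> //; move: dec; rewrite block_decomposition_positive_version//.
Qed.

Lemma block_norm_positive_version :
  block_norm mu Q w' p t r = block_norm mu Q w p t r.
Proof.
apply/funext => f; congr ereal_inf; apply/seteqP.
by split=> c [lam [b [dec cE]]]; exists lam, b; split=> //; move: dec;
  rewrite block_decomposition_positive_version.
Qed.

Lemma BM_norm_positive_version g : measurable_fun setT g ->
  BM_norm mu Q w' p t r g = BM_norm mu Q w p t r g.
Proof.
move=> mg; congr lr_norm; apply/funext => i.
by rewrite wmeas_positive_version// integral_positive_version.
Qed.

Lemma BM_space_positive_version :
  BM_space rho mu Q w' p t r = BM_space rho mu Q w p t r.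
Proof.
apply/seteqP; split=> g [[mg loc] gfin]; split.
- split=> // x s s0; rewrite -integral_positive_version//; exact: loc.
- by rewrite -BM_norm_positive_version.
- split=> // x s s0; rewrite integral_positive_version//; exact: loc.
- by rewrite BM_norm_positive_version.
Qed.

End positive_weight.

Lemma integral_positive_gt0 {R : realType} {d : measure_display}
    {X : measurableType d} (mu : {measure set X -> \bar R}) (A : set X)
    (f : X -> R) : measurable A -> measurable_fun setT f ->
  (forall x, 0 < f x) -> (0 < mu A)%E -> (0 < \int[mu]_(x in A) (f x)%:E)%E.
Proof.
move=> mA mf f0 A0.
have int0 : (0 <= \int[mu]_(x in A) (f x)%:E)%E.
  by apply: integral_ge0 => x _; rewrite lee_fin ltW.
rewrite lt_neqAle int0 andbT; apply/negP => /eqP/esym E.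
have mfA : measurable_fun A (EFin \o f).
  by apply/measurable_EFinP; exact: measurable_funTS.
have : ae_eq mu A (EFin \o f) (cst 0%E).
  apply/(ae_eq_integral_abs mu mA mfA); rewrite -[RHS]E.
  by apply: eq_integral => x _; rewrite /= ger0_norm// ltW.
move=> [Z [mZ Z0 ZA]].
have : (mu A <= mu Z)%E.
  apply: le_measure; rewrite ?inE// => x Ax; apply: ZA => /= /(_ Ax) [fx].
  by have := f0 x; rewrite fx ltxx.
by rewrite Z0 => /(lt_le_trans A0); rewrite ltxx.
Qed.

(** * Weights of class A_p are admissible *)

Section Ap_weights.
Context {R : realType} {d : measure_display} {X : measurableType d}.
Variables (rho : X -> X -> R) (mu : {measure set X -> \bar R}) (n : R).
Hypothesis hX : homogeneous_space rho mu n.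
Variables (I : int -> choiceType) (Q : forall k : int, I k -> set X).
Hypothesis hQ : dyadic_system rho mu Q.
Variables (p : R) (hp : 1 < p) (w : X -> R) (hw : Ap rho mu p w).
Local Notation w' := (positive_version w).

Let mw : measurable_fun setT w. Proof. by have [[]] := hw. Qed.
Let w0 : {ae mu, forall x, 0 < w x}. Proof. by have [[]] := hw. Qed.
Let mball x s : measurable (qball rho x s).
Proof. exact: (hs_measurable_ball hX). Qed.

(** The mean of [w] over the ball is positive, so an infinite mean of the dual weight would make the
    product in the A_p constant infinite. *)
Lemma Ap_dual_integral_fin x s : 0 < s ->
  (\int[mu]_(y in qball rho x s) (dual_weight p w y)%:E < +oo)%E.
Proof.
move=> s0; set B := qball rho x s; have mB : measurable B by exact: mball.
have /andP[B0 Boo] := hs_volume hX x s0.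
have Bfin : mu B \is a fin_num by rewrite ge0_fin_numE// ltW.
have b0 : 0 < fine (mu B) by rewrite fine_gt0// B0.
have BV : ((mu B)^-1 = (fine (mu B))^-1%:E)%E.
  by rewrite -[in LHS](fineK Bfin) inver gt_eqF.
have wB : (0 < mean mu w B)%E.
  rewrite /mean BV mule_gt0 ?lte_fin ?invr_gt0//.
  rewrite -/(wmeas mu w B) -wmeas_positive_version//.
  apply: integral_positive_gt0 => //.
    exact: measurable_positive_version.
  exact: positive_version_gt0.
rewrite ltey; apply/eqP => vB.
have vBoo : (mean mu (dual_weight p w) B `^ (p - 1) = +oo)%E.
  rewrite /mean vB BV gt0_mulye ?lte_fin ?invr_gt0// poweRyr//.
  by rewrite gt_eqF// subr_gt0.
have := hw.2; rewrite ltNge => /negP; apply; rewrite -(gt0_muley wB) -vBoo.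
by apply: ereal_sup_ubound; exists x, s.
Qed.

(** Each cube lies in a ball, on which [w] is integrable as a weight and its dual weight is
    integrable by the A_p condition. *)
Lemma Ap_admissible (r : \bar R) :
  (exists2 s, r = s%:E & 1 < s) \/ r = +oo%E -> admissible mu Q w' p r.
Proof.
move=> hr.
have mQ (i : {k : int & I k}) : measurable (Q (projT2 i)).
  exact: (measurable_cube hX hQ).
have ballQ (i : {k : int & I k}) :
    exists x s, 0 < s /\ Q (projT2 i) `<=` qball rho x s.
  have [x Qx _] := cube_center hX hQ (projT2 i).
  have [s s0 /(_ _ _ Qx) Qs] := cube_bounded hQ (projT1 i).
  by exists x, s.
split=> //.
- exact: measurable_positive_version.
- exact: positive_version_gt0.
- exact: (countable_cubes hX hQ).
- move=> i; have /andP[Q0 _] := mu_cube hX hQ (projT2 i).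
  apply/andP; split.
    apply: integral_positive_gt0 => //; first exact: measurable_positive_version.
    exact: positive_version_gt0.
  have [x [s [s0 Qs]]] := ballQ i.
  apply: (@le_lt_trans _ _ (wmeas mu w' (qball rho x s))).
    apply: ge0_subset_integral => //.
      apply/measurable_EFinP/measurable_funTS; exact: measurable_positive_version.
    by move=> y _; rewrite lee_fin ltW// positive_version_gt0.
  rewrite wmeas_positive_version//.
  have [[_ /(_ x s s0)/integrableP[_ +] _] _] := hw.
  apply: le_lt_trans; apply: (le_trans (lee_abs _)).
  apply: le_abse_integral => //.
  by apply/measurable_EFinP; exact: measurable_funTS.
- move=> i; have [x [s [s0 Qs]]] := ballQ i.
  apply: le_lt_trans (Ap_dual_integral_fin x s0).
  rewrite -[leRHS]integral_dual_weight_positive_version//.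
  apply: ge0_subset_integral => //.
    apply/measurable_EFinP/measurable_funTS/measurable_dual_weight.
    exact: measurable_positive_version.
  by move=> y _; rewrite lee_fin ltW// dual_weight_gt0// => z;
    exact: positive_version_gt0.
Qed.

End Ap_weights.

Theorem theorem3p7 (R : realType) (d : measure_display) (X : measurableType d)
    (rho : X -> X -> R) (mu : {measure set X -> \bar R}) (n : R)
    (hX : homogeneous_space rho mu n)
    (I : int -> choiceType) (Q : forall k : int, I k -> set X)
    (hQ : dyadic_system rho mu Q)
    (alpha0 : R) (hrd : reverse_doubling mu Q alpha0)
    (p : R) (hp : 1 < p) (w : X -> R) (hw : Ap rho mu p w)
    (t : R) (r : \bar R)
    (htr : (exists s : R, [/\ r = s%:E, p < t &
              t < Num.min s
                    (log2 (beta_weight rho mu alpha0 p w)^-1 * s / n)])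
           \/ (p <= t /\ r = +oo%E)) :
  let M := BM_space rho mu Q w p t r in
  let normM := BM_norm mu Q w p t r in
  let H := block_space mu Q w p t r in
  let normH := block_norm mu Q w p t r in
  (forall g, M g ->
     [/\ forall f, H f -> mu.-integrable setT (fun x => (f x * g x)%:E),
         linear_on H (pairing mu g) &
         bounded_on H normH (pairing mu g)])
  /\
  (forall J, in_dual H normH J ->
     exists g, [/\ M g,
       forall f, H f -> J f = pairing mu g f,
       forall h, M h -> (forall f, H f -> J f = pairing mu h f) ->
         {ae mu, forall x, h x = g x} &
       normM g = dual_norm H normH J]).
Proof.
move=> M normM H normH.
have hr : (exists2 s, r = s%:E & 1 < s) \/ r = +oo%E.
  case: htr => [[s [-> pt ts]]|[_ ->]]; [left|by right].
  exists s => //; apply: (lt_trans hp); apply: (lt_trans pt).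
  by apply: (lt_le_trans ts); rewrite ge_min lexx.
have adm := Ap_admissible hX hQ hp hw hr.
have [[mw _ w0] _] := hw.
have mQ k (tau : I k) : measurable (Q k tau) by exact: (measurable_cube hX hQ).
have mball x s : measurable (qball rho x s) by exact: (hs_measurable_ball hX).
(* Replaces [mu] by the same measure with the sigma-finite structure needed for Radon-Nikodym. *)
have [nu nuE] := sigma_finite_measure_of (sigma_finite_homogeneous hX).
have [i0 _] : exists i : {k : int & I k}, True.
  (* Without cubes, all of [X], of infinite measure, would be the uncovered null set. *)
  apply: contrapT => no; have := ds_cover hQ 0.
  rewrite (_ : ~` _ = setT) ?(hs_infinite hX)//.
  apply/seteqP; split=> // x _ [tau _ _]; apply: no.
  by exists (existT (fun k => I k) 0 tau).
subst mu.
have [dual1 dual2] := block_BM_duality adm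
  (@cube_disjoint _ _ _ _ _ _ hX _ _ hQ 0) (cubes_cover hX hQ 0) i0
  (BM_norm_Lp_loc hX hQ adm (t := t)).
(* The duality holds for the everywhere positive version of [w]; spaces and norms are now carried
   back to [w]. The two Bourgain-Morrey norms are compared for measurable functions, which is why
   the norm identity waits until [g] is at hand. *)
move: dual1 dual2.
rewrite block_space_positive_version// block_norm_positive_version//.
rewrite BM_space_positive_version// -/M -/H -/normH => dual1 dual2.
split=> // J /dual2[g [Mg gJ guniq gnorm]]; exists g; split=> //.
have [[mg _] _] := Mg.
by rewrite -gnorm BM_norm_positive_version.
Qed.
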